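(* Let $(\mathcal{C},\mathbb{E},\mathfrak{s})$ be an extriangulated category satisfying (WIC), let $\xi$ be a proper class of $\mathbb{E}$-triangles in $\mathcal{C}$, and assume that $\mathcal{C}$ has enough $\xi$-projectives and enough $\xi$-injectives. Let $M$ be an object of finite $\xi$-$\mathcal{G}$projective dimension and $N$ an object of finite $\xi$-$\mathcal{G}$injective dimension. Then $$\widetilde{\xi{\rm xt}}^i_{\mathcal{P}}(M,N)\cong\widetilde{\xi{\rm xt}}^i_{\mathcal{I}}(M,N)$$ for every $i\in\mathbb{Z}$.
   Context: Extriangulated categories (Nakaoka--Palu). $\mathcal{C}$ is an additive category with an additive bifunctor $\mathbb{E}:\mathcal{C}^{\rm op}\times\mathcal{C}\to{\rm Ab}$. Elements $\delta\in\mathbb{E}(C,A)$ are $\mathbb{E}$-extensions; for $a:A\to A'$ and $c:C'\to C$ write $a_*\delta=\mathbb{E}(C,a)(\delta)$, $c^*\delta=\mathbb{E}(c,A)(\delta)$. A morphism $\delta\to\delta'$ ($\delta\in\mathbb{E}(C,A)$, $\delta'\in\mathbb{E}(C',A')$) is a pair $(a:A\to A',c:C\to C')$ with $a_*\delta=c^*\delta'$. Sequences $A\to B\to C$ and $A\to B'\to C$ are equivalent if there is an isomorphism $B\cong B'$ compatible with the maps. $\mathfrak{s}$ assigns to each $\delta\in\mathbb{E}(C,A)$ an equivalence class $\mathfrak{s}(\delta)=[A\xrightarrow{x}B\xrightarrow{y}C]$ such that every morphism $(a,c)$ of extensions lifts to a commutative $(a,b,c)$, with $\mathfrak{s}(0)=[A\to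 A\oplus C\to C]$ and $\mathfrak{s}(\delta\oplus\delta')=\mathfrak{s}(\delta)\oplus\mathfrak{s}(\delta')$. Axioms: (ET3) for $\delta,\delta'$ realized by $A\xrightarrow{x}B\xrightarrow{y}C$, $A'\xrightarrow{x'}B'\xrightarrow{y'}C'$ and $a,b$ with $bx=x'a$ there is $c$ with $cy=y'b$ and $a_*\delta=c^*\delta'$; (ET4) if $\delta\in\mathbb{E}(D,A)$ is realized by $A\xrightarrow{f}B\xrightarrow{f'}D$ and $\delta'\in\mathbb{E}(F,B)$ by $B\xrightarrow{g}C\xrightarrow{g'}F$, there are an object $E$, maps $d:D\to E$, $e:E\to F$, $h':C\to E$ and $\delta''\in\mathbb{E}(E,A)$ realized by $A\xrightarrow{gf}C\xrightarrow{h'}E$ with $h'g=df'$, $eh'=g'$, $D\xrightarrow{d}E\xrightarrow{e}F$ realizing $f'_*\delta'$, $d^*\delta''=\delta$, $f_*\delta''=e^*\delta'$; and the duals of (ET3), (ET4). If $A\xrightarrow{x}B\xrightarrow{y}C$ realizes $\delta$, then $A\xrightarrow{x}B\xrightarrow{y}C\overset{\delta}{\dashrightarrow}$ is an $\mathbb{E}$-triangle, $x$ is an inflation and $y$ a deflation. It is split if $\delta=0$. (WIC): if $gf$ is an inflation then so is $f$; if $gf$ is a deflation then so is $g$. Proper class. A class $\xi$ of $\mathbb{E}$-triangles closed under isomorphisms is proper if: it is closed under finite coproducts and contains all split $\mathbb{E}$-triangles; it is closed under base change ($\delta\mapsto c^*\delta$) and cobase change ($\delta\mapsto a_*\delta$);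 and it is saturated: for $\mathbb{E}$-triangles $A_i\xrightarrow{x_i}B_i\xrightarrow{y_i}C\overset{\delta_i}{\dashrightarrow}$ ($i=1,2$), if the $\mathbb{E}$-triangles of $\delta_2$ and of $y_2^*\delta_1$ are in $\xi$, then so is that of $\delta_1$. Relative notions. $P$ is $\xi$-projective if $0\to\mathcal{C}(P,A)\to\mathcal{C}(P,B)\to\mathcal{C}(P,C)\to0$ is exact for every $\mathbb{E}$-triangle $A\to B\to C\dashrightarrow$ in $\xi$; $\xi$-injective is dual. $\mathcal{P}(\xi)$, $\mathcal{I}(\xi)$ are the classes of $\xi$-projectives and $\xi$-injectives. Enough $\xi$-projectives: each $A$ admits an $\mathbb{E}$-triangle $K\to P\to A\dashrightarrow$ in $\xi$ with $P\in\mathcal{P}(\xi)$; enough $\xi$-injectives is dual. Complexes are written homologically. A complex $\mathbf{X}$ is $\xi$-exact if for each $n$ there is an $\mathbb{E}$-triangle $K_{n+1}\xrightarrow{g_n}X_n\xrightarrow{f_n}K_n\dashrightarrow$ in $\xi$ with $d_n=g_{n-1}f_n$. A complete $\xi$-projective resolution is a $\xi$-exact complex of $\xi$-projectives (indexed by $\mathbb{Z}$) whose $\mathbb{E}$-triangles $K_{n+1}\to P_n\to K_n\dashrightarrow$ can be chosen so that $0\to\mathcal{C}(K_n,W)\to\mathcal{C}(P_n,W)\to\mathcal{C}(K_{n+1},W)\to0$ is exact for all $W\in\mathcal{P}(\xi)$; the objects $K_n$ are then called $\xi$-$\mathcal{G}$projective. Dually, a complete $\xi$-injective coresolution is a $\xi$-exact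 complex of $\xi$-injectives whose $\mathbb{E}$-triangles stay short exact under $\mathcal{C}(W,-)$ for all $W\in\mathcal{I}(\xi)$; the objects $K_n$ are $\xi$-$\mathcal{G}$injective. The $\xi$-$\mathcal{G}$projective dimension is defined inductively: it is $0$ for $\xi$-$\mathcal{G}$projectives, and it is $\le n$ for $A$ if there is an $\mathbb{E}$-triangle $K\to G\to A\dashrightarrow$ in $\xi$ with $G$ $\xi$-$\mathcal{G}$projective and $K$ of $\xi$-$\mathcal{G}$projective dimension $\le n-1$; $\xi$-$\mathcal{G}$injective dimension is dual. Complete cohomology. A $\xi$-projective resolution of $M$ is a $\xi$-exact complex $\cdots\to P_1\to P_0\to M\to0$ with $P_n\in\mathcal{P}(\xi)$ ($\mathbf{P}_M$ denotes the complex of the $P_n$); a $\xi$-injective coresolution $N\to\mathbf{I}_N$ is a $\xi$-exact complex $0\to N\to I_0\to I_{-1}\to\cdots$ with $I_n\in\mathcal{I}(\xi)$. $\mathcal{C}(\mathbf{X},\mathbf{Y})$ is the Hom complex with $\mathcal{C}(\mathbf{X},\mathbf{Y})_n=\prod_i\mathcal{C}(X_i,Y_{i+n})$ and $d(\varphi)_i=d^{\mathbf{Y}}_{i+n}\varphi_i-(-1)^n\varphi_{i-1}d^{\mathbf{X}}_i$; $H^n$ is the homology in homological degree $-n$. Let $\overline{\mathcal{C}}(\mathbf{P}_M,\mathbf{P}_N)$ be the subcomplex of families with $\varphi_i=0$ for $i\gg0$ and $\underline{\mathcal{C}}(\mathbf{I}_M,\mathbf{I}_N)$ that of families with $\varphi_i=0$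 for $i\ll0$. Then $\widetilde{\xi{\rm xt}}^n_{\mathcal{P}}(M,N)=H^n\big(\mathcal{C}(\mathbf{P}_M,\mathbf{P}_N)/\overline{\mathcal{C}}(\mathbf{P}_M,\mathbf{P}_N)\big)$ and $\widetilde{\xi{\rm xt}}^n_{\mathcal{I}}(M,N)=H^n\big(\mathcal{C}(\mathbf{I}_M,\mathbf{I}_N)/\underline{\mathcal{C}}(\mathbf{I}_M,\mathbf{I}_N)\big)$, $n\in\mathbb{Z}$. *)

(* Defs.v *)
(* [boolp] supplies classical decidability, so that arbitrary
   subgroups and quotients of zmodTypes are again zmodTypes. *)
From HB Require Import structures.
From mathcomp Require Import all_boot all_order all_algebra.
From mathcomp Require Import boolp.
From mathcomp Require Import zify.

Set Implicit Arguments.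
Unset Strict Implicit.
Unset Printing Implicit Defensive.

Import Order.TTheory GRing.Theory Num.Theory.
Local Open Scope ring_scope.

Fact int_predK (n : int) : n - 1 + 1 = n.
Proof. exact: subrK. Qed.

(* Homological grading.  The equation [n + 1 = m] is carried as an argument so
   that no transport along equalities of degrees is ever needed. *)
Record abComplex := AbComplex {
  abc_grp :> int -> zmodType;
  abc_d : forall m n : int, n + 1 = m -> {additive abc_grp m -> abc_grp n};
  abc_dd : forall (l m n : int) (e : m + 1 = l) (e' : n + 1 = m) x,
    abc_d e' (abc_d e x) = 0 }.

Section Homology.
Variable A : abComplex.
Variable n : int.

Let dout : {additive A n -> A (n - 1)%R} := abc_d A (int_predK n).
Let din : {additive A (n + 1)%R -> A n} := abc_d A (erefl (n + 1)).

Definition is_cycle : {pred A n} := fun x => dout x == 0.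

Fact is_cycle_zmod_closed : zmod_closed is_cycle.
Proof.
split; first by rewrite unfold_in raddf0.
by move=> x y /eqP x0 /eqP y0; rewrite unfold_in raddfB x0 y0 subrr.
Qed.
HB.instance Definition _ :=
  GRing.isZmodClosed.Build (A n) is_cycle is_cycle_zmod_closed.

Record cycle := Cycle { cycle_val : A n; _ : cycle_val \in is_cycle }.
HB.instance Definition _ := [isSub for cycle_val].
HB.instance Definition _ := [Choice of cycle by <:].
HB.instance Definition _ := [SubChoice_isSubZmodule of cycle by <:].

Definition is_boundary : {pred cycle} :=
  fun z => `[< exists y, din y = cycle_val z >].

Fact is_boundary_zmod_closed : zmod_closed is_boundary.
Proof.
split; first by apply/asboolP; exists 0; rewrite raddf0.
move=> x y /asboolP[u Hu] /asboolP[v Hv]; apply/asboolP; exists (u - v).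
by rewrite raddfB Hu Hv.
Qed.
HB.instance Definition _ :=
  GRing.isZmodClosed.Build cycle is_boundary is_boundary_zmod_closed.

Definition homology : zmodType := Quotient.quot is_boundary.

End Homology.

Record subcomplex (A : abComplex) := Subcomplex {
  sub_grp :> forall n, zmodClosed (A n);
  sub_d : forall m n (e : n + 1 = m) x,
    x \in sub_grp m -> abc_d A e x \in sub_grp n }.

Section QuotientComplex.
Local Open Scope quotient_scope.
Variables (A : abComplex) (S : subcomplex A).

Definition quot_grp (n : int) : zmodType := Quotient.quot (S n).

Definition quot_d m n (e : n + 1 = m) (x : quot_grp m) : quot_grp n :=
  \pi_(Quotient.quot (S n)) (abc_d A e (repr x)).

Lemma quot_d_pi m n (e : n + 1 = m) (x : A m) :
  quot_d e (\pi_(Quotient.quot (S m)) x) = \pi_(Quotient.quot (S n)) (abc_d A e x).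
Proof.
apply/eqP; rewrite -Quotient.idealrBE -raddfB; apply: sub_d.
by rewrite Quotient.idealrBE reprK.
Qed.

Fact quot_d_zmod_morphism m n (e : n + 1 = m) : zmod_morphism (@quot_d m n e).
Proof.
move=> x y; rewrite -[x]reprK -[y]reprK -raddfB !quot_d_pi.
by rewrite -raddfB -raddfB.
Qed.
HB.instance Definition _ m n (e : n + 1 = m) :=
  GRing.isZmodMorphism.Build (quot_grp m) (quot_grp n) (@quot_d m n e)
    (@quot_d_zmod_morphism m n e).

Fact quot_dd l m n (e : m + 1 = l) (e' : n + 1 = m) x :
  quot_d e' (quot_d e x) = 0.
Proof. by rewrite -[x]reprK !quot_d_pi abc_dd raddf0. Qed.

Definition quotient_complex : abComplex :=
  @AbComplex quot_grp (fun m n e => @quot_d m n e) quot_dd.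

End QuotientComplex.

Definition ab_isomorphic (U V : zmodType) : Prop :=
  exists f : {additive U -> V}, bijective f.

Definition short_exact (U V W : zmodType) (f : U -> V) (g : V -> W) : Prop :=
  [/\ injective f, (forall v, g v = 0 <-> exists u, f u = v)
    & forall w, exists v, g v = w].

Reserved Notation "g ∘ f" (at level 40, left associativity).

Record additiveCategory := AdditiveCategory {
  obj :> Type;
  hom : obj -> obj -> zmodType;
  idm : forall A, hom A A;
  comp : forall A B C, hom B C -> hom A B -> hom A C
    where "g ∘ f" := (comp g f);
  comp_idl : forall A B (f : hom A B), idm B ∘ f = f;
  comp_idr : forall A B (f : hom A B), f ∘ idm A = f;
  comp_assoc : forall A B C D (h : hom C D) (g : hom B C) (f : hom A B),
    h ∘ (g ∘ f) = h ∘ g ∘ f;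
  comp_addl : forall A B C (g g' : hom B C) (f : hom A B),
    (g + g') ∘ f = g ∘ f + g' ∘ f;
  comp_addr : forall A B C (g : hom B C) (f f' : hom A B),
    g ∘ (f + f') = g ∘ f + g ∘ f';
  zobj : obj;
  zobjP : idm zobj = 0;
  bip : obj -> obj -> obj;
  in1 : forall A B, hom A (bip A B);
  in2 : forall A B, hom B (bip A B);
  pr1 : forall A B, hom (bip A B) A;
  pr2 : forall A B, hom (bip A B) B;
  pr1_in1 : forall A B, pr1 A B ∘ in1 A B = idm A;
  pr2_in2 : forall A B, pr2 A B ∘ in2 A B = idm B;
  pr1_in2 : forall A B, pr1 A B ∘ in2 A B = 0;
  pr2_in1 : forall A B, pr2 A B ∘ in1 A B = 0;
  bip_id : forall A B,
    in1 A B ∘ pr1 A B + in2 A B ∘ pr2 A B = idm (bip A B) }.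

Arguments idm {_} A.
Arguments in1 {_} A B.
Arguments in2 {_} A B.
Arguments pr1 {_} A B.
Arguments pr2 {_} A B.
Notation "g ∘ f" := (comp g f) : ring_scope.

Section AdditiveCategoryTheory.
Variable C : additiveCategory.
Implicit Types A B D : C.

Definition is_iso A B (f : hom A B) : Prop :=
  exists g : hom B A, g ∘ f = idm A /\ f ∘ g = idm B.

Definition is_zero_obj A : Prop := idm A = 0.

Definition hom_sum A B A' B' (f : hom A B) (f' : hom A' B') :
    hom (bip A A') (bip B B') :=
  in1 B B' ∘ f ∘ pr1 A A' + in2 B B' ∘ f' ∘ pr2 A A'.

Definition seq_equiv A B B' D (x : hom A B) (y : hom B D)
    (x' : hom A B') (y' : hom B' D) : Prop :=
  exists b : hom B B', [/\ is_iso b, b ∘ x = x' & y' ∘ b = y].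

Lemma comp0m A B D (f : hom A B) : (0 : hom B D) ∘ f = 0.
Proof. by apply: (addrI (0 ∘ f)); rewrite -comp_addl !addr0. Qed.

Lemma compm0 A B D (g : hom B D) : g ∘ (0 : hom A B) = 0.
Proof. by apply: (addrI (g ∘ 0)); rewrite -comp_addr !addr0. Qed.

Lemma comp_oppl A B D (g : hom B D) (f : hom A B) : (- g) ∘ f = - (g ∘ f).
Proof. by apply: (addrI (g ∘ f)); rewrite -comp_addl !subrr comp0m. Qed.

Lemma comp_oppr A B D (g : hom B D) (f : hom A B) : g ∘ (- f) = - (g ∘ f).
Proof. by apply: (addrI (g ∘ f)); rewrite -comp_addr !subrr compm0. Qed.

Lemma comp_mulzl A B D (g : hom B D) (f : hom A B) (k : int) :
  (g *~ k) ∘ f = (g ∘ f) *~ k.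
Proof.
have natE m : (g *+ m) ∘ f = (g ∘ f) *+ m.
  elim: m => [|m IH]; first by rewrite !mulr0n comp0m.
  by rewrite !mulrS comp_addl IH.
by case: k => m; rewrite ?NegzE ?mulrNz ?comp_oppl -!pmulrn natE.
Qed.

Lemma comp_mulzr A B D (g : hom B D) (f : hom A B) (k : int) :
  g ∘ (f *~ k) = (g ∘ f) *~ k.
Proof.
have natE m : g ∘ (f *+ m) = (g ∘ f) *+ m.
  elim: m => [|m IH]; first by rewrite !mulr0n compm0.
  by rewrite !mulrS comp_addr IH.
by case: k => m; rewrite ?NegzE ?mulrNz ?comp_oppr -!pmulrn natE.
Qed.

End AdditiveCategoryTheory.

Record complex (C : additiveCategory) := Complex {
  cx_obj :> int -> C;
  cx_d : forall i j : int, j + 1 = i -> hom (cx_obj i) (cx_obj j);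
  cx_dd : forall (i j k : int) (e : j + 1 = i) (e' : k + 1 = j),
    cx_d e' ∘ cx_d e = 0 }.

Section HomComplex.
Variables (C : additiveCategory) (X Y : complex C).

(* The product over i of hom (X i) (Y (i + n)): the index q is determined by
   p and n, and equality proofs in int are unique. *)
Definition cochain (n : int) : Type :=
  forall p q : int, p + n = q -> hom (X p) (Y q).

Section CochainGroup.
Variable n : int.
Implicit Types f g h : cochain n.

Definition cochain_zero : cochain n := fun p q e => 0.
Definition cochain_opp f : cochain n := fun p q e => - f p q e.
Definition cochain_add f g : cochain n := fun p q e => f p q e + g p q e.

Lemma cochainP f g : (forall p q e, f p q e = g p q e) -> f = g.
Proof.
by move=> fg; do 3!(apply: functional_extensionality_dep => ?); apply: fg.
Qed.

Fact cochain_addA : associative cochain_add.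
Proof. by move=> f g h; apply: cochainP => p q e; apply: addrA. Qed.
Fact cochain_addC : commutative cochain_add.
Proof. by move=> f g; apply: cochainP => p q e; apply: addrC. Qed.
Fact cochain_add0 : left_id cochain_zero cochain_add.
Proof. by move=> f; apply: cochainP => p q e; apply: add0r. Qed.
Fact cochain_addN : left_inverse cochain_zero cochain_opp cochain_add.
Proof. by move=> f; apply: cochainP => p q e; apply: addNr. Qed.

HB.instance Definition _ := gen_eqMixin (cochain n).
HB.instance Definition _ := gen_choiceMixin (cochain n).
HB.instance Definition _ := GRing.isZmodule.Build (cochain n)
  cochain_addA cochain_addC cochain_add0 cochain_addN.

Lemma cochainBE f g p q e : (f - g) p q e = f p q e - g p q e.
Proof. by []. Qed.

End CochainGroup.

Fact hom_d_eq1 (m n p q : int) : n + 1 = m -> p + n = q -> p + m = q + 1.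
Proof. by move=> <- <-; rewrite addrA. Qed.

Fact hom_d_eq2 (m n p q : int) : n + 1 = m -> p + n = q -> p - 1 + m = q.
Proof. by move=> <- <-; rewrite [n + 1]addrC addrA subrK. Qed.

Definition hom_d (m n : int) (e : n + 1 = m) (f : cochain m) : cochain n :=
  fun p q e' =>
    cx_d Y (erefl (q + 1)) ∘ f p (q + 1) (hom_d_eq1 e e')
    - (f (p - 1) q (hom_d_eq2 e e') ∘ cx_d X (int_predK p)) *~ ((-1) ^ m).

Fact hom_d_zmod_morphism m n (e : n + 1 = m) : zmod_morphism (hom_d e).
Proof.
move=> f g; apply: cochainP => p q e'; rewrite cochainBE /hom_d !cochainBE.
rewrite comp_addr comp_addl comp_oppr comp_oppl mulrzBl.
by rewrite !opprD !opprK addrACA.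
Qed.
HB.instance Definition _ m n (e : n + 1 = m) :=
  GRing.isZmodMorphism.Build (cochain m) (cochain n) (hom_d e)
    (@hom_d_zmod_morphism m n e).

Fact hom_dd l m n (e : m + 1 = l) (e' : n + 1 = m) (f : cochain l) :
  hom_d e' (hom_d e f) = 0.
Proof.
apply: cochainP => p q ep; rewrite /hom_d.
rewrite comp_addr comp_addl comp_oppr comp_oppl.
rewrite comp_mulzr comp_mulzl.
rewrite !comp_assoc cx_dd comp0m sub0r -[X in _ - (_ - X *~ _) *~ _]comp_assoc.
rewrite cx_dd compm0 mul0rz subr0.
have -> : ((-1) ^ l : int) = - (-1) ^ m by rewrite -e exprzDr // mulrN1.
rewrite mulrNz opprK.
set a := hom_d_eq2 _ _; set b := hom_d_eq1 _ _.
by rewrite (eq_irrelevance a b) subrr.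
Qed.

Definition hom_complex : abComplex :=
  @AbComplex (fun n => cochain n) (fun m n e => hom_d e) hom_dd.

Definition bounded_above (n : int) : {pred hom_complex n} :=
  fun f => `[< exists b : int, forall p q (e : p + n = q), b < p ->
               (f : cochain n) p q e = 0 >].

Definition bounded_below (n : int) : {pred hom_complex n} :=
  fun f => `[< exists b : int, forall p q (e : p + n = q), p < b ->
               (f : cochain n) p q e = 0 >].

Fact bounded_above_zmod_closed n : zmod_closed (@bounded_above n).
Proof.
split; first by apply/asboolP; exists 0.
move=> f g /asboolP[b Hb] /asboolP[c Hc]; apply/asboolP.
exists (Num.max b c) => p q e; rewrite gt_max => /andP[bp cp].
by rewrite cochainBE Hb // Hc // subrr.
Qed.
HB.instance Definition _ n := GRing.isZmodClosed.Build (hom_complex n)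
  (@bounded_above n) (@bounded_above_zmod_closed n).

Fact bounded_below_zmod_closed n : zmod_closed (@bounded_below n).
Proof.
split; first by apply/asboolP; exists 0.
move=> f g /asboolP[b Hb] /asboolP[c Hc]; apply/asboolP.
exists (Num.min b c) => p q e; rewrite lt_min => /andP[bp cp].
by rewrite cochainBE Hb // Hc // subrr.
Qed.
HB.instance Definition _ n := GRing.isZmodClosed.Build (hom_complex n)
  (@bounded_below n) (@bounded_below_zmod_closed n).

Fact bounded_above_d m n (e : n + 1 = m) f :
  f \in @bounded_above m -> abc_d hom_complex e f \in @bounded_above n.
Proof.
move=> /asboolP[b Hb]; apply/asboolP; exists (b + 1) => p q e' bp.
by rewrite /= /hom_d !Hb ?compm0 ?comp0m ?mul0rz ?subrr //; lia.
Qed.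

Fact bounded_below_d m n (e : n + 1 = m) f :
  f \in @bounded_below m -> abc_d hom_complex e f \in @bounded_below n.
Proof.
move=> /asboolP[b Hb]; apply/asboolP; exists b => p q e' bp.
by rewrite /= /hom_d !Hb ?compm0 ?comp0m ?mul0rz ?subrr //; lia.
Qed.

Definition bounded_above_sub : subcomplex hom_complex :=
  @Subcomplex hom_complex (fun n => @bounded_above n) bounded_above_d.

Definition bounded_below_sub : subcomplex hom_complex :=
  @Subcomplex hom_complex (fun n => @bounded_below n) bounded_below_d.

End HomComplex.

Record additiveBifunctor (C : additiveCategory) := AdditiveBifunctor {
  ext : C -> C -> zmodType;
  push : forall (D A A' : C), hom A A' -> ext D A -> ext D A';
  pull : forall (D D' A : C), hom D' D -> ext D A -> ext D' A;
  push_add : forall D A A' (a : hom A A') (d d' : ext D A),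
    push a (d + d') = push a d + push a d';
  pull_add : forall D D' A (c : hom D' D) (d d' : ext D A),
    pull c (d + d') = pull c d + pull c d';
  push_addm : forall D A A' (a a' : hom A A') (d : ext D A),
    push (a + a') d = push a d + push a' d;
  pull_addm : forall D D' A (c c' : hom D' D) (d : ext D A),
    pull (c + c') d = pull c d + pull c' d;
  push_id : forall D A (d : ext D A), push (idm A) d = d;
  pull_id : forall D A (d : ext D A), pull (idm D) d = d;
  push_comp : forall D A A' A'' (a' : hom A' A'') (a : hom A A')
    (d : ext D A), push (a' ∘ a) d = push a' (push a d);
  pull_comp : forall D D' D'' A (c : hom D' D) (c' : hom D'' D')
    (d : ext D A), pull (c ∘ c') d = pull c' (pull c d);
  push_pull : forall D D' A A' (a : hom A A') (c : hom D' D) (d : ext D A),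
    push a (pull c d) = pull c (push a d) }.

(* The element of E(D + D', A + A') corresponding to (d, 0, 0, d'). *)
Definition ext_sum (C : additiveCategory) (E : additiveBifunctor C)
    (A A' D D' : C) (d : ext E D A) (d' : ext E D' A') :
    ext E (bip D D') (bip A A') :=
  push (in1 A A') (pull (pr1 D D') d) + push (in2 A A') (pull (pr2 D D') d').

Record extriangulatedCategory := ExtriangulatedCategory {
  et_cat :> additiveCategory;
  et_ext : additiveBifunctor et_cat;
  (* [realizes x y d] : the sequence (x, y) belongs to the class s(d). *)
  realizes : forall A B D : et_cat,
    hom A B -> hom B D -> ext et_ext D A -> Prop;
  realizes_ex : forall A D (d : ext et_ext D A),
    exists B (x : hom A B) (y : hom B D), realizes x y d;
  realizes_class : forall A D (d : ext et_ext D A)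
    B (x : hom A B) (y : hom B D) B' (x' : hom A B') (y' : hom B' D),
    realizes x y d -> (realizes x' y' d <-> seq_equiv x y x' y');
  realizes_lift : forall A B D (x : hom A B) (y : hom B D) d
    A' B' D' (x' : hom A' B') (y' : hom B' D') d'
    (a : hom A A') (c : hom D D'),
    realizes x y d -> realizes x' y' d' -> push a d = pull c d' ->
    exists b : hom B B', b ∘ x = x' ∘ a /\ y' ∘ b = c ∘ y;
  realizes_zero : forall A D, realizes (in1 A D) (pr2 A D) 0;
  realizes_sum : forall A B D (x : hom A B) (y : hom B D) d
    A' B' D' (x' : hom A' B') (y' : hom B' D') d',
    realizes x y d -> realizes x' y' d' ->
    realizes (hom_sum x x') (hom_sum y y') (ext_sum d d');
  ET3 : forall A B D (x : hom A B) (y : hom B D) d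
    A' B' D' (x' : hom A' B') (y' : hom B' D') d'
    (a : hom A A') (b : hom B B'),
    realizes x y d -> realizes x' y' d' -> b ∘ x = x' ∘ a ->
    exists c : hom D D', c ∘ y = y' ∘ b /\ push a d = pull c d';
  ET3op : forall A B D (x : hom A B) (y : hom B D) d
    A' B' D' (x' : hom A' B') (y' : hom B' D') d'
    (b : hom B B') (c : hom D D'),
    realizes x y d -> realizes x' y' d' -> c ∘ y = y' ∘ b ->
    exists a : hom A A', b ∘ x = x' ∘ a /\ push a d = pull c d';
  ET4 : forall A B C D F (f : hom A B) (f' : hom B D) (d1 : ext et_ext D A)
    (g : hom B C) (g' : hom C F) (d2 : ext et_ext F B),
    realizes f f' d1 -> realizes g g' d2 ->
    exists (E : et_cat) (d : hom D E) (e : hom E F) (h : hom C E)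
      (d3 : ext et_ext E A),
      realizes (g ∘ f) h d3 /\ h ∘ g = d ∘ f' /\ e ∘ h = g' /\
      realizes d e (push f' d2) /\ pull d d3 = d1 /\ push f d3 = pull e d2;
  ET4op : forall A B C D F (f' : hom D B) (f : hom B A) (d1 : ext et_ext A D)
    (g' : hom F C) (g : hom C B) (d2 : ext et_ext B F),
    realizes f' f d1 -> realizes g' g d2 ->
    exists (E : et_cat) (d : hom E D) (e : hom F E) (h : hom E C)
      (d3 : ext et_ext A E),
      realizes h (f ∘ g) d3 /\ g ∘ h = f' ∘ d /\ h ∘ e = g' /\
      realizes e d (pull f' d2) /\ push d d3 = d1 /\ pull f d3 = push e d2 }.

Arguments realizes {_ A B D} x y d.
Notation "''E' ( D , A )" := (ext (et_ext _) D A)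
  (at level 8, format "''E' ( D ,  A )") : type_scope.

Section Relative.
Variable C : extriangulatedCategory.

Definition inflation (A B : C) (x : hom A B) : Prop :=
  exists (D : C) (y : hom B D) (d : 'E(D, A)), realizes x y d.

Definition deflation (B D : C) (y : hom B D) : Prop :=
  exists (A : C) (x : hom A B) (d : 'E(D, A)), realizes x y d.

Definition WIC : Prop :=
  (forall (X Y Z : C) (f : hom X Y) (g : hom Y Z),
     inflation (g ∘ f) -> inflation f) /\
  (forall (X Y Z : C) (f : hom X Y) (g : hom Y Z),
     deflation (g ∘ f) -> deflation g).

Definition triangle_class : Type :=
  forall A B D : C, hom A B -> hom B D -> 'E(D, A) -> Prop.

Record proper_class (xi : triangle_class) : Prop := ProperClass {
  proper_realizes : forall A B D (x : hom A B) (y : hom B D) d,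
    xi _ _ _ x y d -> realizes x y d;
  proper_iso : forall A B D (x : hom A B) (y : hom B D) d
    A' B' D' (x' : hom A' B') (y' : hom B' D') d'
    (a : hom A A') (b : hom B B') (c : hom D D'),
    xi _ _ _ x y d -> realizes x' y' d' ->
    is_iso a -> is_iso b -> is_iso c ->
    b ∘ x = x' ∘ a -> c ∘ y = y' ∘ b -> push a d = pull c d' ->
    xi _ _ _ x' y' d';
  (* with [proper_split], the empty coproduct is covered *)
  proper_sum : forall A B D (x : hom A B) (y : hom B D) d
    A' B' D' (x' : hom A' B') (y' : hom B' D') d',
    xi _ _ _ x y d -> xi _ _ _ x' y' d' ->
    xi _ _ _ (hom_sum x x') (hom_sum y y') (ext_sum d d');
  proper_split : forall A B D (x : hom A B) (y : hom B D),
    realizes x y 0 -> xi _ _ _ x y 0;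
  proper_base : forall A B D (x : hom A B) (y : hom B D) d
    D' (c : hom D' D) B' (x' : hom A B') (y' : hom B' D'),
    xi _ _ _ x y d -> realizes x' y' (pull c d) ->
    xi _ _ _ x' y' (pull c d);
  proper_cobase : forall A B D (x : hom A B) (y : hom B D) d
    A' (a : hom A A') B' (x' : hom A' B') (y' : hom B' D),
    xi _ _ _ x y d -> realizes x' y' (push a d) ->
    xi _ _ _ x' y' (push a d);
  proper_saturated : forall D
    A1 B1 (x1 : hom A1 B1) (y1 : hom B1 D) d1
    A2 B2 (x2 : hom A2 B2) (y2 : hom B2 D) d2
    B (x : hom A1 B) (y : hom B B2),
    realizes x1 y1 d1 -> xi _ _ _ x2 y2 d2 ->
    xi _ _ _ x y (pull y2 d1) ->
    xi _ _ _ x1 y1 d1 }.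

Variable xi : triangle_class.

Definition hom_exact_from (W A B D : C) (x : hom A B) (y : hom B D) : Prop :=
  short_exact (fun u : hom W A => x ∘ u) (fun v : hom W B => y ∘ v).

Definition hom_exact_to (W A B D : C) (x : hom A B) (y : hom B D) : Prop :=
  short_exact (fun u : hom D W => u ∘ y) (fun v : hom B W => v ∘ x).

Definition xi_projective (P : C) : Prop :=
  forall (A B D : C) (x : hom A B) (y : hom B D) d,
    xi x y d -> hom_exact_from P x y.

Definition xi_injective (I : C) : Prop :=
  forall (A B D : C) (x : hom A B) (y : hom B D) d,
    xi x y d -> hom_exact_to I x y.

Definition enough_xi_projectives : Prop :=
  forall A : C, exists (K P : C) (x : hom K P) (y : hom P A) d,
    xi x y d /\ xi_projective P.

Definition enough_xi_injectives : Prop :=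
  forall A : C, exists (I K : C) (x : hom A I) (y : hom I K) d,
    xi x y d /\ xi_injective I.

(* Triangles K_(n+1) -g_n-> X_n -f_n-> K_n exhibiting a complex X indexed by
   all integers as xi-exact, together with the objects K_n. *)
Record xi_exact_with (X : complex C) (K : int -> C)
    (g : forall n, hom (K (n + 1)) (X n)) (f : forall n, hom (X n) (K n)) :
    Prop := XiExactWith {
  xi_exact_tri : forall n, exists d, xi (g n) (f n) d;
  xi_exact_d : forall n, cx_d X (erefl (n + 1)) = g n ∘ f (n + 1) }.

Definition xiG_projective (A : C) : Prop :=
  exists (P : complex C) (K : int -> C)
    (g : forall n, hom (K (n + 1)) (P n)) (f : forall n, hom (P n) (K n)),
    [/\ xi_exact_with g f, (forall n, xi_projective (P n)),
        (forall n W, xi_projective W -> hom_exact_to W (g n) (f n))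
      & exists n, K n = A].

Definition xiG_injective (A : C) : Prop :=
  exists (I : complex C) (K : int -> C)
    (g : forall n, hom (K (n + 1)) (I n)) (f : forall n, hom (I n) (K n)),
    [/\ xi_exact_with g f, (forall n, xi_injective (I n)),
        (forall n W, xi_injective W -> hom_exact_from W (g n) (f n))
      & exists n, K n = A].

Fixpoint xiG_projdim_le (n : nat) (A : C) : Prop :=
  if n is m.+1 then
    exists (K G : C) (x : hom K G) (y : hom G A) d,
      [/\ xi x y d, xiG_projective G & xiG_projdim_le m K]
  else xiG_projective A.

Fixpoint xiG_injdim_le (n : nat) (A : C) : Prop :=
  if n is m.+1 then
    exists (G K : C) (x : hom A G) (y : hom G K) d,
      [/\ xi x y d, xiG_injective G & xiG_injdim_le m K]
  else xiG_injective A.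

Definition finite_xiG_projdim (A : C) : Prop := exists n, xiG_projdim_le n A.
Definition finite_xiG_injdim (A : C) : Prop := exists n, xiG_injdim_le n A.

(* The sequence M, L_0, L_1, ... *)
Definition syzygy (M : C) (L : nat -> C) (n : nat) : C :=
  if n is m.+1 then L m else M.

(* [P] is the deleted complex P_M: zero in negative degrees, with triangles
   K_(n+1) -> P_n -> K_n for n >= 0 and K_0 = M, the augmentation P_0 -> M
   being f_0. *)
Definition xi_projective_resolution (M : C) (P : complex C) : Prop :=
  [/\ (forall n : int, n < 0 -> is_zero_obj (P n)),
      (forall n : nat, xi_projective (P n))
    & exists (L : nat -> C) (K := syzygy M L)
        (g : forall n : nat, hom (K n.+1) (P n))
        (f : forall n : nat, hom (P n) (K n)),
        (forall n, exists d, xi (g n) (f n) d) /\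
        (forall (n : nat) (e : n%:Z + 1 = n.+1%:Z),
           cx_d P e = g n ∘ f n.+1)].

(* [I] is the deleted complex I_N: zero in positive degrees, with triangles
   K_n -> I_(-n) -> K_(n+1) for n >= 0 and K_0 = N, the coaugmentation
   N -> I_0 being g_0. *)
Definition xi_injective_coresolution (N : C) (I : complex C) : Prop :=
  [/\ (forall n : int, 0 < n -> is_zero_obj (I n)),
      (forall n : nat, xi_injective (I (- n%:Z)))
    & exists (L : nat -> C) (K := syzygy N L)
        (g : forall n : nat, hom (K n) (I (- n%:Z)))
        (f : forall n : nat, hom (I (- n%:Z)) (K n.+1)),
        (forall n, exists d, xi (g n) (f n) d) /\
        (forall (n : nat) (e : - n.+1%:Z + 1 = - n%:Z),
           cx_d I e = g n.+1 ∘ f n)].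

End Relative.

(* H^n is the homology in homological degree - n. *)
Definition complete_ext_P (C : additiveCategory) (PM PN : complex C)
    (n : int) : zmodType :=
  homology (quotient_complex (bounded_above_sub PM PN)) (- n).

Definition complete_ext_I (C : additiveCategory) (IM IN : complex C)
    (n : int) : zmodType :=
  homology (quotient_complex (bounded_below_sub IM IN)) (- n).

(* Main.v *)
(* The theorem only uses that C(P,-) and C(-,I) are exact on the triangles of xi
   for P xi-projective and I xi-injective.  Let T be a totally acyclic complex of
   xi-projectives agreeing with P_M in high degrees, S dually for I_N, and Z_N the
   xi-exact complex obtained by splicing P_N and I_N along N.  Write
   H^+, H^- and H for the cohomology of Hom complexes modulo cochains vanishing
   near +oo, modulo cochains vanishing near -oo, and of the full Hom complex.
   Since C(T,W) is exact for W projective or injective, and C(T_p,-) is exact on Z_N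
   and S, the quotient maps C(T,-) -> C(T,-)/(...) are quasi-isomorphisms, so
     H^+(P_M,P_N) = H^+(T,P_N) = H^+(T,Z_N) = H(T,Z_N) = H^-(T,Z_N)
       = H^-(T,I_N) = H^-(T,S) = H(T,S),
   and dually H^-(I_M,I_N) = H(T,S).  T is built by induction on the dimension of M,
   as the mapping cone of an extension to all degrees of a germ of chain maps. *)
Require Import Defs.
From HB Require Import structures.
From mathcomp Require Import all_boot all_order all_algebra.
From mathcomp Require Import boolp zify.
Import Defs.

Set Implicit Arguments.
Unset Strict Implicit.
Unset Printing Implicit Defensive.

Import Order.TTheory GRing.Theory Num.Theory.
Local Open Scope ring_scope.

(** * Homology of quotient complexes *)

(** Dividing out the cochains that vanish near an end changes nothing when the subcomplex of those
    cochains is acyclic. A cocycle in it bounds: start a null-homotopy with 0 where the cocycle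
    vanishes and continue it one source degree at a time, away from that end. Starting at -oo, each
    step uses exactness of C(T_p,-) on the target; starting at +oo, exactness of C(T,W) for the
    terms W of the target. The pair (T, Z_N) allows both, which links the two ends. The terms of Z_N
    are projective in one half and injective in the other, so total acyclicity of T must cover both
    kinds of W; for injective W it comes from the triangles of T lying in xi.

    Z_N is realised as the mapping cone of P_N -> N -> I_N. This puts P_N one degree higher and
    accounts for the degree n + 1 in which T is compared with S.

    The second chain of isomorphisms is the first one in the opposite category. The core is
    therefore stated for an additive category with two classes of objects, data that dualise without
    touching the bifunctor or the realization. The price is that degrees are negated and that - - p
    = p holds only propositionally. *)

Lemma ab_isomorphic_trans (V U W : zmodType) :
  ab_isomorphic U V -> ab_isomorphic V W -> ab_isomorphic U W.
Proof.
move=> [f bf] [g bg]; exists (g \o f : {additive U -> W}); exact: bij_comp.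
Qed.

Lemma bijective_of (U V : zmodType) (f : U -> V) :
  zmod_morphism f -> (forall x, f x = 0 -> x = 0) ->
  (forall y, exists x, f x = y) -> ab_isomorphic U V.
Proof.
move=> fB finj fsurj.
pose g : {additive U -> V} := HB.pack f (GRing.isZmodMorphism.Build U V f fB).
exists g; pose h y := projT1 (cid (fsurj y)).
have hK y : f (h y) = y by exact: (projT2 (cid (fsurj y))).
exists h => [x|]; last exact: hK.
by apply/eqP; rewrite -subr_eq0; apply/eqP/finj; rewrite fB hK subrr.
Qed.

Lemma ab_isomorphic_sym (U V : zmodType) :
  ab_isomorphic U V -> ab_isomorphic V U.
Proof.
move=> [f [g fK gK]]; apply: (@bijective_of _ _ g).
- by move=> x y; rewrite -{1}(gK x) -{1}(gK y) -raddfB fK.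
- by move=> x x0; rewrite -(gK x) x0 raddf0.
- by move=> y; exists (f y).
Qed.

(* [c] identifies [H] with the subquotient [Z / B] of [G]. *)
Definition presents (G H : zmodType) (Z B : G -> Prop) (c : G -> H) : Prop :=
  [/\ forall x y, Z x -> Z y -> Z (x - y) /\ c (x - y) = c x - c y,
      forall h, exists x, Z x /\ c x = h
    & forall x, Z x -> (c x = 0 <-> B x)].

(** Subquotients are compared through a map of the ambient groups, so later arguments handle
    cochains and never a quotient type. The induced map picks a representative by choice; [FE] shows
    that the resulting class does not depend on it. *)
Lemma presents_iso (G H : zmodType) Z B (c : G -> H)
    (G' H' : zmodType) Z' B' (c' : G' -> H') (f : G -> G') :
  presents Z B c -> presents Z' B' c' -> zmod_morphism f ->
  (forall x, Z x -> Z' (f x)) -> (forall x, Z x -> B x -> B' (f x)) ->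
  (forall x, Z x -> B' (f x) -> B x) ->
  (forall w, Z' w -> exists z, Z z /\ B' (w - f z)) ->
  ab_isomorphic H H'.
Proof.
move=> [cB csurj c0] [cB' csurj' c0'] fB fZ fBB finj fsurj.
pose r h := projT1 (cid (csurj h)).
have rP h : Z (r h) /\ c (r h) = h by exact: (projT2 (cid (csurj h))).
have FE x : Z x -> c' (f (r (c x))) = c' (f x).
  move=> Zx; have [Zr cr] := rP (c x).
  have [Zrx crx] := cB _ _ Zr Zx.
  apply/eqP; rewrite -subr_eq0 -(cB' _ _ (fZ _ Zr) (fZ _ Zx)).2 -fB.
  by apply/eqP/c0'; [exact: fZ|apply: fBB => //; apply/c0; rewrite // crx cr subrr].
apply: (@bijective_of _ _ (fun h => c' (f (r h)))).
- move=> h k; have [[Zh ch] [Zk ck]] := (rP h, rP k).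
  have [Zhk chk] := cB _ _ Zh Zk.
  by rewrite -{1}ch -{1}ck -chk FE // fB (cB' _ _ (fZ _ Zh) (fZ _ Zk)).2.
- move=> h; have [Zh ch] := rP h => /(c0' _ (fZ _ Zh)) Bh.
  by rewrite -ch; apply/c0 => //; exact: finj Bh.
- move=> h'; have [w [Zw <-]] := csurj' h'; have [z [Zz Bz]] := fsurj w Zw.
  exists (c z); rewrite FE //; have [Zwz cwz] := cB' _ _ Zw (fZ _ Zz).
  by apply/esym/eqP; rewrite -subr_eq0 -cwz; apply/eqP/c0'.
Qed.

Section QuotientHomology.
Local Open Scope quotient_scope.
Variables (A : abComplex) (S : subcomplex A) (n : int).

(** Made total by [insubd]: an [x] that is not a relative cycle gets the class of 0. The map is thus
    meaningful, and additive, only on relative cycles, which is all that [presents] asks. *)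
Definition relative_class (x : A n) : homology (quotient_complex S) n :=
  \pi_(homology (quotient_complex S) n)
    (insubd (0 : Defs.cycle (quotient_complex S) n) (\pi_(Quotient.quot (S n)) x)).

Let piE m (x : A m) : (\pi_(Quotient.quot (S m)) x == 0) = (x \in S m).
Proof. by rewrite -(raddf0 (\pi_(Quotient.quot (S m)))) -Quotient.idealrBE subr0. Qed.

Let in_cycle (x : A n) : (\pi_(Quotient.quot (S n)) x \in @is_cycle (quotient_complex S) n)
  = (abc_d A (int_predK n) x \in S (n - 1)).
Proof. by rewrite -piE -quot_d_pi. Qed.

Lemma relative_classP : presents
  (fun x => abc_d A (int_predK n) x \in S (n - 1))
  (fun x => exists y, x - abc_d A (erefl (n + 1)) y \in S n) relative_class.
Proof.
split.
- move=> x y Zx Zy; have Zxy : abc_d A (int_predK n) (x - y) \in S (n - 1).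
    by rewrite raddfB rpredB.
  split=> //; rewrite /relative_class -raddfB; congr (\pi _).
  apply: val_inj; rewrite [RHS]raddfB /= !val_insubd !in_cycle Zx Zy Zxy.
  by rewrite raddfB.
- move=> h; exists (repr (cycle_val (repr h))).
  rewrite -in_cycle reprK /relative_class reprK.
  case: (repr h) (reprK h) => z zc <-; split => //=.
  by congr (\pi _); apply: val_inj; rewrite val_insubd zc.
- move=> x Zx; rewrite /relative_class.
  set z := insubd _ _.
  have zE : cycle_val z = \pi_(Quotient.quot (S n)) x.
    by rewrite -[cycle_val z]/(val z) val_insubd in_cycle Zx.
  have -> : (\pi_(homology (quotient_complex S) n) z = 0) <-> z \in @is_boundary (quotient_complex S) n.
    rewrite -[0](raddf0 \pi_(homology (quotient_complex S) n)).
    split=> [/eqP|H]; first by rewrite -Quotient.idealrBE subr0.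
    by apply/eqP; rewrite -Quotient.idealrBE subr0.
  split=> [/asboolP[y]|[y Sy]].
    rewrite zE -[y]reprK /= quot_d_pi => /eqP; rewrite eq_sym -Quotient.idealrBE.
    by exists (repr y).
  apply/asboolP; exists (\pi_(Quotient.quot (S (n + 1))) y); rewrite zE /= quot_d_pi.
  by apply/eqP; rewrite eq_sym -Quotient.idealrBE.
Qed.

End QuotientHomology.

(** * Hom complexes modulo eventually vanishing cochains *)

(* Neighbourhood filters of an end of the integers, used to express which
   cochains are divided out; the trivial filter divides out nothing. *)
Record tail := Tail {
  tail_in :> (int -> Prop) -> Prop;
  tail_all : forall P : int -> Prop, (forall p, P p) -> tail_in P;
  tail_sub2 : forall P Q R : int -> Prop,
    tail_in P -> tail_in Q -> (forall p, P p -> Q p -> R p) -> tail_in R;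
  tail_shift : forall (P : int -> Prop) (k : int),
    tail_in P -> tail_in (fun p => P (p + k)) }.

Lemma tail_sub (F : tail) (P Q : int -> Prop) :
  F P -> (forall p, P p -> Q p) -> F Q.
Proof. by move=> FP PQ; apply: (tail_sub2 FP FP) => p Pp _; apply: PQ. Qed.

Program Definition at_top : tail :=
  @Tail (fun P => exists b, forall p, b < p -> P p) _ _ _.
Next Obligation. by exists 0. Qed.
Next Obligation.
exists (Num.max H0 H) => p; rewrite gt_max => /andP[? ?].
by apply: H1; auto.
Qed.
Next Obligation. by exists (H - k) => p ?; apply: H0; lia. Qed.

Program Definition at_bottom : tail :=
  @Tail (fun P => exists b, forall p, p < b -> P p) _ _ _.
Next Obligation. by exists 0. Qed.
Next Obligation.
exists (Num.min H0 H) => p; rewrite lt_min => /andP[? ?].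
by apply: H1; auto.
Qed.
Next Obligation. by exists (H - k) => p ?; apply: H0; lia. Qed.

Program Definition everywhere : tail := @Tail (fun P => forall p, P p) _ _ _.

Section Cochains.
Variable C : additiveCategory.
Implicit Types X Y Z W : complex C.

Definition tr X (p q : int) (e : p = q) : hom (X p) (X q) :=
  match e in _ = r return hom (X p) (X r) with erefl => idm (X p) end.

Lemma tr_id X p (e : p = p) : tr X e = idm (X p).
Proof. by rewrite (eq_irrelevance e erefl). Qed.

Lemma cochain_irr X Y n (f : cochain X Y n) p q (e e' : p + n = q) :
  f p q e = f p q e'.
Proof. by rewrite (eq_irrelevance e e'). Qed.

Lemma cx_d_irr X i j (e e' : j + 1 = i) : cx_d X e = cx_d X e'.
Proof. by rewrite (eq_irrelevance e e'). Qed.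

(** The second test is there for typing: when [q0 = p0 + n], it succeeds whenever the first one
    does. *)
Definition patch X Y n (f : cochain X Y n) p0 q0 (u : hom (X p0) (Y q0)) :
    cochain X Y n :=
  fun p q e => match p =P p0, q0 =P q with
    | ReflectT ep, ReflectT eq => tr Y eq ∘ u ∘ tr X ep
    | _, _ => f p q e
    end.

Lemma patch_at X Y n (f : cochain X Y n) p q (u : hom (X p) (Y q)) e :
  patch f u e = u.
Proof.
rewrite /patch; case: eqP => // ep; case: eqP => // eq.
by rewrite !tr_id comp_idl comp_idr.
Qed.

Lemma patch_off X Y n (f : cochain X Y n) p0 q0 (u : hom (X p0) (Y q0)) p q e :
  p <> p0 -> patch f u e = f p q e.
Proof. by move=> np; rewrite /patch; case: eqP. Qed.

(** Frees the differential from the literal degrees [q + 1] and [p - 1]. Proofs can name the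
    neighbouring degrees, get the equations from [lia], and never transport a morphism. *)
Lemma hom_dE X Y m n (e : n + 1 = m) (f : cochain X Y m) p q (e' : p + n = q)
    q1 (eq : q + 1 = q1) (e1 : p + m = q1) p1 (ep : p1 + 1 = p) (e2 : p1 + m = q) :
  hom_d e f e' = cx_d Y eq ∘ f p q1 e1 - (f p1 q e2 ∘ cx_d X ep) *~ ((-1) ^ m).
Proof.
rewrite /hom_d; case: q1 / eq e1 => e1.
have E : p1 = p - 1 by lia.
move: ep e2; rewrite E => ep e2.
by rewrite (cx_d_irr X (int_predK p) ep) (cochain_irr f (hom_d_eq1 e e') e1)
  (cochain_irr f (hom_d_eq2 e e') e2).
Qed.

Lemma hom_d_irr X Y m n n' (e : n + 1 = m) (e' : n' + 1 = m)
    (f : cochain X Y m) p q ep ep' : hom_d e f ep = hom_d e' f (p := p) (q := q) ep'.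
Proof.
have E : n' = n by lia.
by move: e' ep'; rewrite E => e' ep'; rewrite (eq_irrelevance e' e) (eq_irrelevance ep' ep).
Qed.

Lemma sgnS (n m : int) : n + 1 = m -> ((-1) ^ m : int) = - (-1) ^ n.
Proof. by move=> <-; rewrite exprzDr // mulrN1. Qed.

Lemma sgnD (n k : int) : ((-1) ^ (n + k) : int) = (-1) ^ n * (-1) ^ k.
Proof. by rewrite exprzDr. Qed.

Lemma sgn2 (n : int) : ((-1) ^ n * (-1) ^ n : int) = 1.
Proof. by rewrite -exprzMl ?unitrN1 // mulrNN mulr1 exp1rz. Qed.

Definition eventually (F : tail) X Y n (f : cochain X Y n) : Prop :=
  F (fun p => forall q e, f p q e = 0).

Fact comp_cochain_eq (n k m p q : int) : n + k = m -> p + m = q -> p + n + k = q.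
Proof. lia. Qed.

Definition comp_cochain X Y Z n k m (e : n + k = m) (u : cochain Y Z k)
    (f : cochain X Y n) : cochain X Z m :=
  fun p q e' => u (p + n) q (comp_cochain_eq e e') ∘ f p (p + n) erefl.

Lemma comp_cochainE X Y Z n k m (e : n + k = m) (u : cochain Y Z k)
    (f : cochain X Y n) p q (e' : p + m = q) r (er : p + n = r) (ek : r + k = q) :
  comp_cochain e u f e' = u r q ek ∘ f p r er.
Proof. by case: r / er ek => ek; rewrite /comp_cochain (cochain_irr u _ ek). Qed.

Lemma cochainDE X Y n (f g : cochain X Y n) p q e :
  (f + g) p q e = f p q e + g p q e.
Proof. by []. Qed.
Lemma cochainNE X Y n (f : cochain X Y n) p q e : (- f) p q e = - f p q e.
Proof. by []. Qed.
Lemma cochain0E X Y n p q e : (0 : cochain X Y n) p q e = 0.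
Proof. by []. Qed.

Lemma cochainMzE X Y n (f : cochain X Y n) (k : int) p q e :
  (f *~ k) p q e = f p q e *~ k.
Proof.
have E m : (f *+ m) p q e = f p q e *+ m.
  by elim: m => [|m IH] //; rewrite !mulrS cochainDE IH.
by case: k => m; rewrite ?NegzE ?mulrNz ?cochainNE -!pmulrn E.
Qed.

(** The Leibniz rule: the two copies of [u d f] cancel. It is what lets composition act on tail
    homology. *)
Lemma hom_d_comp X Y Z n k m n' k' m' (e : n + k = m) (en : n' + 1 = n)
    (ek : k' + 1 = k) (em : m' + 1 = m) (e1 : n + k' = m') (e2 : n' + k = m')
    (u : cochain Y Z k) (f : cochain X Y n) :
  hom_d em (comp_cochain e u f) = comp_cochain e1 (hom_d ek u) f
    + comp_cochain e2 u (hom_d en f) *~ ((-1) ^ k).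
Proof.
apply: cochainP => p q e'.
have [r [q1 [p1 [r1 [er eq ep er1]]]]] :
    exists r q1 p1 r1, [/\ p + n = r, q + 1 = q1, p1 + 1 = p & r1 + 1 = r].
  by exists (p + n), (q + 1), (p - 1), (p + n - 1); split; lia.
have [Hq1 Hr1 Hq Hr Hr1'] : [/\ p + m = q1, p1 + n = r1, r + k' = q, r + k = q1 & r1 + k = q].
  by split; lia.
have Hp1 : p1 + m = q by lia.
have Hpr1 : p + n' = r1 by lia.
rewrite cochainDE cochainMzE (hom_dE em _ e' eq Hq1 ep Hp1).
rewrite (comp_cochainE _ _ _ _ er Hr) (comp_cochainE _ _ _ _ Hr1 Hr1').
rewrite (comp_cochainE _ _ _ _ er Hq) (comp_cochainE _ _ _ _ Hpr1 Hr1').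
rewrite (hom_dE _ _ Hq eq Hr er1 Hr1') (hom_dE _ _ Hpr1 er1 er ep Hr1).
rewrite comp_addl comp_oppl comp_addr comp_oppr comp_mulzl comp_mulzr !comp_assoc.
rewrite mulrzBl -!mulrzA -e sgnD addrA subrK.
by congr (_ - _ *~ _); rewrite mulrC.
Qed.

Lemma comp_cochainA X Y Z W a b c ab bc abc (e1 : a + b = ab) (e2 : b + c = bc)
    (e3 : ab + c = abc) (e4 : a + bc = abc)
    (h : cochain Z W c) (g : cochain Y Z b) (f : cochain X Y a) :
  comp_cochain e3 h (comp_cochain e1 g f) = comp_cochain e4 (comp_cochain e2 h g) f.
Proof.
apply: cochainP => p q e.
have [r [s [er es]]] : exists r s, p + a = r /\ p + ab = s.
  by exists (p + a), (p + ab).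
have [Hs Hq Hrq] : [/\ r + b = s, s + c = q & r + bc = q] by split; lia.
rewrite (comp_cochainE _ _ _ _ es Hq) (comp_cochainE _ _ _ _ er Hs).
by rewrite (comp_cochainE _ _ _ _ er Hrq) (comp_cochainE _ _ _ _ Hs Hq) comp_assoc.
Qed.

Lemma comp_cochainBl X Y Z n k m (e : n + k = m) (u v : cochain Y Z k)
    (f : cochain X Y n) :
  comp_cochain e (u - v) f = comp_cochain e u f - comp_cochain e v f.
Proof. by apply: cochainP => p q e'; rewrite /comp_cochain !cochainBE comp_addl comp_oppl. Qed.

Lemma comp_cochainBr X Y Z n k m (e : n + k = m) (u : cochain Y Z k)
    (f g : cochain X Y n) :
  comp_cochain e u (f - g) = comp_cochain e u f - comp_cochain e u g.
Proof. by apply: cochainP => p q e'; rewrite /comp_cochain !cochainBE comp_addr comp_oppr. Qed.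

Definition id_cochain X : cochain X X 0 :=
  fun p q e => tr X (etrans (esym (addr0 p)) e).

Lemma id_cochain_id X p (e : p + 0 = p) : id_cochain X e = idm (X p).
Proof. exact: tr_id. Qed.

Lemma comp_id_cochain X Y n (e : n + 0 = n) (f : cochain X Y n) :
  comp_cochain e (id_cochain Y) f = f.
Proof.
apply: cochainP => p q e'; rewrite (comp_cochainE _ _ _ e' e' (addr0 q)).
by rewrite id_cochain_id comp_idl.
Qed.

Lemma comp_cochain_id X Y n (e : 0 + n = n) (f : cochain X Y n) :
  comp_cochain e f (id_cochain X) = f.
Proof.
apply: cochainP => p q e'; rewrite (comp_cochainE _ _ _ e' (addr0 p) e').
by rewrite id_cochain_id comp_idr.
Qed.

Section Eventually.
Variable F : tail.

Lemma eventually0 X Y n : eventually F (0 : cochain X Y n).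
Proof. exact: tail_all. Qed.

Lemma eventuallyB X Y n (f g : cochain X Y n) :
  eventually F f -> eventually F g -> eventually F (f - g).
Proof.
move=> Ff Fg; apply: (tail_sub2 Ff Fg) => p fp gp q e.
by rewrite cochainBE fp gp subrr.
Qed.

Lemma eventuallyN X Y n (f : cochain X Y n) : eventually F f -> eventually F (- f).
Proof. by rewrite -[- f]sub0r; apply: eventuallyB; apply: eventually0. Qed.

Lemma eventuallyD X Y n (f g : cochain X Y n) :
  eventually F f -> eventually F g -> eventually F (f + g).
Proof. by move=> Ff Fg; rewrite -[g]opprK; apply/eventuallyB/eventuallyN. Qed.

Lemma eventuallyMz X Y n (f : cochain X Y n) (z : int) :
  eventually F f -> eventually F (f *~ z).
Proof.
by move=> Ff; apply: (tail_sub Ff) => p fp q e; rewrite cochainMzE fp mul0rz.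
Qed.

Lemma eventually_compr X Y Z n k m (e : n + k = m) (u : cochain Y Z k)
    (f : cochain X Y n) : eventually F f -> eventually F (comp_cochain e u f).
Proof.
by move=> Ff; apply: (tail_sub Ff) => p fp q e'; rewrite /comp_cochain fp compm0.
Qed.

(** Vanishing of [u] is a condition on degrees of [Y], which [f] reaches from degrees of [X] lower
    by [n]; this is one reason why a [tail] must be stable under shifts. *)
Lemma eventually_compl X Y Z n k m (e : n + k = m) (u : cochain Y Z k)
    (f : cochain X Y n) : eventually F u -> eventually F (comp_cochain e u f).
Proof.
move=> Fu; apply: (tail_sub (tail_shift n Fu)) => p up q e'.
by rewrite /comp_cochain up comp0m.
Qed.

Lemma eventually_d X Y m n (e : n + 1 = m) (f : cochain X Y m) :
  eventually F f -> eventually F (hom_d e f).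
Proof.
move=> Ff; apply: (tail_sub2 Ff (tail_shift (-1) Ff)) => p fp fp1 q e'.
by rewrite /hom_d fp fp1 compm0 comp0m mul0rz subrr.
Qed.

Definition eventually_pred X Y n : {pred hom_complex X Y n} :=
  fun f => `[< @eventually F X Y n f >].

Fact eventually_zmod_closed X Y n : zmod_closed (@eventually_pred X Y n).
Proof.
split; first exact/asboolP/eventually0.
by move=> f g /asboolP Ff /asboolP Fg; apply/asboolP/eventuallyB.
Qed.
HB.instance Definition _ X Y n := GRing.isZmodClosed.Build (hom_complex X Y n)
  (@eventually_pred X Y n) (@eventually_zmod_closed X Y n).

Fact eventually_pred_d X Y m n (e : n + 1 = m) f :
  f \in @eventually_pred X Y m ->
  abc_d (hom_complex X Y) e f \in @eventually_pred X Y n.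
Proof. by move=> /asboolP Ff; apply/asboolP; apply: eventually_d. Qed.

Definition eventually_sub X Y : subcomplex (hom_complex X Y) :=
  @Subcomplex (hom_complex X Y) (fun n => @eventually_pred X Y n)
    (@eventually_pred_d X Y).

Definition tail_homology X Y (n : int) : zmodType :=
  homology (quotient_complex (eventually_sub X Y)) n.

Definition tail_cycle X Y n (f : cochain X Y n) : Prop :=
  forall m (e : m + 1 = n), eventually F (hom_d e f).

Definition tail_boundary X Y n (f : cochain X Y n) : Prop :=
  exists m (e : n + 1 = m) (g : cochain X Y m), eventually F (f - hom_d e g).

Lemma tail_cycle_ex X Y n (f : cochain X Y n) m (e : m + 1 = n) :
  eventually F (hom_d e f) -> tail_cycle f.
Proof.
move=> Ff m' e'; apply: (tail_sub Ff) => p fp q ep.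
have ep' : p + m = q by lia.
by rewrite (hom_d_irr e' e f ep ep').
Qed.

Lemma tail_homologyP X Y n : presents (@tail_cycle X Y n) (@tail_boundary X Y n)
  (@relative_class _ (eventually_sub X Y) n).
Proof.
have cycE f : tail_cycle f <-> abc_d (hom_complex X Y) (int_predK n) f
    \in eventually_sub X Y (n - 1).
  by split=> [cf|/asboolP]; [by apply/asboolP; apply: cf|exact: tail_cycle_ex].
have bndE f : tail_boundary f <-> exists g,
    f - abc_d (hom_complex X Y) (erefl (n + 1)) g \in eventually_sub X Y n.
  split=> [[m [e [g]]]|[g /asboolP]]; last by exists (n + 1), erefl, g.
  by case: m / e g => g Fg; exists g; apply/asboolP.
have [H1 H2 H3] := relative_classP (eventually_sub X Y) n.
split.
- by move=> x y /cycE Zx /cycE Zy; have [? ?] := H1 x y Zx Zy; split=> //; apply/cycE.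
- by move=> h; have [x [Zx <-]] := H2 h; exists x; split=> //; apply/cycE.
- by move=> x /cycE Zx; rewrite H3 // bndE.
Qed.

Lemma tail_boundaryN X Y n (f : cochain X Y n) :
  tail_boundary f -> tail_boundary (- f).
Proof.
move=> [m [e [g Fg]]]; exists m, e, (- g).
by rewrite raddfN -opprD; apply: eventuallyN.
Qed.

Lemma tail_boundaryD X Y n (f f' : cochain X Y n) :
  tail_boundary f -> tail_boundary f' -> tail_boundary (f + f').
Proof.
move=> [m [e [g Fg]]] [m' [e' [g' Fg']]].
have E : m' = m by lia.
move: e' g' Fg'; rewrite E => e' g' Fg'; rewrite (eq_irrelevance e' e) in Fg'.
exists m, e, (g + g').
have -> : hom_d e (g + g') = hom_d e g + hom_d e g' by exact: raddfD.
by rewrite opprD addrACA; apply: eventuallyD.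
Qed.

Lemma tail_boundary_ev X Y n (f : cochain X Y n) :
  eventually F f -> tail_boundary f.
Proof. by move=> Ff; exists (n + 1), erefl, 0; rewrite raddf0 subr0. Qed.

Lemma tail_boundary_d X Y n m (e : n + 1 = m) (g : cochain X Y m) :
  tail_boundary (hom_d e g).
Proof. by exists m, e, g; rewrite subrr; apply: eventually0. Qed.

End Eventually.
End Cochains.

(** Two categories, two tails and two degrees are allowed, so that duality, change of tail and shift
    all use this one criterion. *)
Lemma tail_homology_iso (C C' : additiveCategory) (F F' : tail)
    (X Y : complex C) (X' Y' : complex C') n n'
    (f : cochain X Y n -> cochain X' Y' n') :
  zmod_morphism f ->
  (forall x, tail_cycle F x -> tail_cycle F' (f x)) ->
  (forall x, tail_cycle F x -> tail_boundary F x -> tail_boundary F' (f x)) ->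
  (forall x, tail_cycle F x -> tail_boundary F' (f x) -> tail_boundary F x) ->
  (forall y, tail_cycle F' y ->
     exists x, tail_cycle F x /\ tail_boundary F' (y - f x)) ->
  ab_isomorphic (tail_homology F X Y n) (tail_homology F' X' Y' n').
Proof. by apply: presents_iso; exact: tail_homologyP. Qed.

(** * Invariance of tail homology under homotopy equivalences near an end *)

Section Composition.
Variables (C : additiveCategory) (F : tail).
Implicit Types X Y Z : complex C.

Lemma tail_boundaryMz X Y n (f : cochain X Y n) (z : int) :
  tail_boundary F f -> tail_boundary F (f *~ z).
Proof.
move=> [m [e [g Fg]]]; exists m, e, (g *~ z).
have -> : hom_d e (g *~ z) = hom_d e g *~ z by exact: raddfMz.
by rewrite -mulrzBl; apply: eventuallyMz.
Qed.

Lemma tail_boundaryB X Y n (f g : cochain X Y n) :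
  tail_boundary F f -> tail_boundary F g -> tail_boundary F (f - g).
Proof. by move=> Bf Bg; apply/tail_boundaryD/tail_boundaryN. Qed.

Lemma tail_cycle_comp X Y Z n k m (e : n + k = m) (u : cochain Y Z k)
    (f : cochain X Y n) :
  tail_cycle F u -> tail_cycle F f -> tail_cycle F (comp_cochain e u f).
Proof.
move=> Zu Zf m' em.
have [e1 e2] : n + (k - 1) = m' /\ n - 1 + k = m' by lia.
rewrite (hom_d_comp e (int_predK n) (int_predK k) em e1 e2).
apply: eventuallyD; first exact: eventually_compl.
exact/eventuallyMz/eventually_compr.
Qed.

(** Replace [f] by [hom_d en g], up to an eventually vanishing term. The Leibniz rule, solved for
    [u] composed with [hom_d en g], leaves a boundary and the composite of [hom_d u] with [g], which
    vanishes eventually because [u] is a tail cycle. *)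
Lemma tail_boundary_compr X Y Z n k m (e : n + k = m) (u : cochain Y Z k)
    (f : cochain X Y n) :
  tail_cycle F u -> tail_boundary F f -> tail_boundary F (comp_cochain e u f).
Proof.
move=> Zu [n' [en [g Fg]]].
have [e1 e2] : n' + (k - 1) = m /\ n' + k = m + 1 by lia.
have dug := hom_d_comp e2 en (int_predK k) (erefl (m + 1)) e1 e u g.
have -> : comp_cochain e u f = comp_cochain e u (f - hom_d en g)
    + (hom_d (erefl (m + 1)) (comp_cochain e2 u g)
       - comp_cochain e1 (hom_d (int_predK k) u) g) *~ ((-1) ^ k).
  by rewrite dug [_ + _ - comp_cochain e1 _ _]addrAC subrr add0r -mulrzA sgn2 mulr1z comp_cochainBr subrK.
apply: tail_boundaryD; first exact/tail_boundary_ev/eventually_compr.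
apply: tail_boundaryMz; apply: tail_boundaryB; first exact: tail_boundary_d.
exact/tail_boundary_ev/eventually_compl.
Qed.

Lemma tail_boundary_compl X Y Z n k m (e : n + k = m) (u : cochain Y Z k)
    (f : cochain X Y n) :
  tail_boundary F u -> tail_cycle F f -> tail_boundary F (comp_cochain e u f).
Proof.
move=> [k' [ek [w Fw]]] Zf.
have [e1 e2] : n + k' = m + 1 /\ n - 1 + k' = m by lia.
have dwf := hom_d_comp e1 (int_predK n) ek (erefl (m + 1)) e e2 w f.
have -> : comp_cochain e u f = comp_cochain e (u - hom_d ek w) f
    + (hom_d (erefl (m + 1)) (comp_cochain e1 w f)
       - comp_cochain e2 w (hom_d (int_predK n) f) *~ ((-1) ^ k')).
  by rewrite dwf addrK comp_cochainBl subrK.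
apply: tail_boundaryD; first exact/tail_boundary_ev/eventually_compl.
apply: tail_boundaryB; first exact: tail_boundary_d.
exact/tail_boundary_ev/eventuallyMz/eventually_compr.
Qed.

(** The maps need to be cycles, and mutually inverse up to homotopy, only near the end. A nonzero
    degree [k] is allowed for the sake of the shift by 1 between a resolution and the splice. *)
Lemma tail_homology_postcomp X Y Y' n k n' k' (e : n + k = n') (e' : n' + k' = n)
    (ek : k + k' = 0) (ek' : k' + k = 0) (u : cochain Y Y' k) (v : cochain Y' Y k') :
  tail_cycle F u -> tail_cycle F v ->
  tail_boundary F (comp_cochain ek v u - id_cochain Y) ->
  tail_boundary F (comp_cochain ek' u v - id_cochain Y') ->
  ab_isomorphic (tail_homology F X Y n) (tail_homology F X Y' n').
Proof.
move=> Zu Zv vu uv; apply: (tail_homology_iso (f := comp_cochain e u)).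
- exact: comp_cochainBr.
- by move=> x; apply: tail_cycle_comp.
- by move=> x _; apply: tail_boundary_compr.
- move=> x Zx /(tail_boundary_compr e' Zv).
  rewrite (comp_cochainA _ ek _ (addr0 n)) => B.
  rewrite -(comp_id_cochain (addr0 n) x).
  rewrite -[comp_cochain _ _ _](subKr (comp_cochain (addr0 n) (comp_cochain ek v u) x)).
  by apply: tail_boundaryB => //; rewrite -comp_cochainBl; apply: tail_boundary_compl.
- move=> y Zy; exists (comp_cochain e' v y); split; first exact: tail_cycle_comp.
  rewrite (comp_cochainA _ ek' _ (addr0 n')) -{1}(comp_id_cochain (addr0 n') y).
  rewrite -opprB -comp_cochainBl; apply: tail_boundaryN.
  exact: tail_boundary_compl.
Qed.

Lemma tail_homology_precomp X X' Y n (u : cochain X' X 0) (v : cochain X X' 0) :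
  tail_cycle F u -> tail_cycle F v ->
  tail_boundary F (comp_cochain (addr0 0) v u - id_cochain X') ->
  tail_boundary F (comp_cochain (addr0 0) u v - id_cochain X) ->
  ab_isomorphic (tail_homology F X Y n) (tail_homology F X' Y n).
Proof.
move=> Zu Zv vu uv; pose e := add0r n.
apply: (tail_homology_iso (f := fun x => comp_cochain e x u)).
- by move=> x y; exact: comp_cochainBl.
- by move=> x Zx; apply: tail_cycle_comp.
- by move=> x Zx Bx; apply: tail_boundary_compl.
- move=> x Zx B; have := tail_boundary_compl e B Zv.
  rewrite -(comp_cochainA (addr0 0) _ _ e) => {}B.
  rewrite -(comp_cochain_id e x).
  rewrite -[comp_cochain _ _ _](subKr (comp_cochain e x (comp_cochain (addr0 0) u v))).
  by apply: tail_boundaryB => //; rewrite -comp_cochainBr; apply: tail_boundary_compr.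
- move=> y Zy; exists (comp_cochain e y v); split; first exact: tail_cycle_comp.
  rewrite -(comp_cochainA (addr0 0) _ _ e) -{1}(comp_cochain_id e y).
  rewrite -opprB -comp_cochainBr; apply: tail_boundaryN.
  exact: tail_boundary_compr.
Qed.

(** It is the subcomplex of eventually vanishing cochains that is acyclic here, not the whole Hom
    complex. *)
Definition acyclic X Y : Prop :=
  forall n m (e : n + 1 = m) (f : cochain X Y n),
    (forall k (ek : k + 1 = n), hom_d ek f = 0) -> eventually F f ->
    exists2 h, eventually F h & hom_d e h = f.

(** The quotient map has an acyclic kernel. If [x - hom_d e g] vanishes eventually, it is a cocycle
    of the kernel, and a primitive of it corrects [g]. If [y] is only a relative cycle, [hom_d y] is
    a cocycle of the kernel, and subtracting a primitive makes [y] a true cycle. *)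
Lemma acyclic_tail_homology X Y n : acyclic X Y ->
  ab_isomorphic (tail_homology everywhere X Y n) (tail_homology F X Y n).
Proof.
have ev0 m (f : cochain X Y m) : eventually everywhere f -> f = 0.
  by move=> f0; apply: cochainP => p q e; apply: f0.
move=> XY0; apply: (@tail_homology_iso _ _ _ _ _ _ _ _ _ _ id) => //.
- by move=> x Zx m e; rewrite (ev0 _ _ (Zx m e)); apply: eventually0.
- move=> x Zx [m [e [g /ev0 xg]]]; exists m, e, g; rewrite xg.
  exact: eventually0.
- move=> x Zx [m [e [g Fg]]]; have [|//|h Fh dh] := XY0 _ _ e (x - hom_d e g).
    move=> k ek; have -> : hom_d ek (x - hom_d e g) = hom_d ek x - hom_d ek (hom_d e g).
      exact: raddfB.
    by rewrite hom_dd subr0; apply: ev0.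
  exists m, e, (g + h); have -> : hom_d e (g + h) = hom_d e g + hom_d e h by exact: raddfD.
  by rewrite dh [hom_d e g + _]addrC subrK subrr; apply: eventually0.
- move=> y Zy; have [|//|h Fh dh] := XY0 _ _ (int_predK n) (hom_d (int_predK n) y).
    by move=> k ek; rewrite hom_dd.
  exists (y - h); split; last first.
    by rewrite opprB [y + _]addrC subrK; apply: tail_boundary_ev.
  apply: (@tail_cycle_ex _ _ _ _ _ _ (n - 1) (int_predK n)).
  have -> : hom_d (int_predK n) (y - h) = hom_d (int_predK n) y - hom_d (int_predK n) h.
    exact: raddfB.
  by rewrite dh subrr; apply: eventually0.
Qed.

End Composition.

(** * Degreewise extension of null-homotopies *)

Definition exact_hom (C : additiveCategory) (Q : C) (Y : complex C) (j : int) : Prop :=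
  forall (i k : int) (ei : j + 1 = i) (ek : k + 1 = j) (r : hom Q (Y j)),
    cx_d Y ek ∘ r = 0 -> exists t, cx_d Y ei ∘ t = r.

Section Extension.
Variables (C : additiveCategory) (X Y : complex C) (n m : int) (e : n + 1 = m).
Variable f : cochain X Y n.
Hypothesis df0 : forall k (ek : k + 1 = n), hom_d ek f = 0.

Let solves (b : int) (h : cochain X Y m) : Prop :=
  forall (p q : int) (ep : p + n = q), p < b -> hom_d e h ep = @f p q ep.

Let agree (b : int) (h h' : cochain X Y m) : Prop :=
  forall (p q : int) (ep : p + m = q), p < b -> h' p q ep = h p q ep.

Lemma extend_null_homotopy_step b h : (forall j, b + n = j -> exact_hom (X b) Y j) ->
  solves b h -> exists h', solves (b + 1) h' /\ agree b h h'.
Proof.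
move=> Yb hb.
have [q [q1 [q0 [b1 [b2 [e1 e2 e3 e4 e5]]]]]] : exists q q1 q0 b1 b2,
  [/\ b + n = q, q + 1 = q1, q0 + 1 = q, b1 + 1 = b & b2 + 1 = b1].
  by exists (b + n), (b + n + 1), (b + n - 1), (b - 1), (b - 1 - 1); split; lia.
have [hq1 b1m b1n b2m] : [/\ b + m = q1, b1 + m = q, b1 + n = q0 & b2 + m = q0].
  by split; lia.
have bn1 : b + (n - 1) = q0 by lia.
pose s : int := (-1) ^ m.
(* The equation at source degree [b] says that the differential of the new component must equal
   [r]. *)
pose r := @f b q e1 + (h b1 q b1m ∘ cx_d X e4) *~ s.
have [t dt] : exists t, cx_d Y e2 ∘ t = r.
  (* [r] is a cycle: [df0] rewrites [d f_b] through [f_(b-1)], the equation already solved at [b1]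
     rewrites that through [h], and the two surviving terms carry the opposite signs of [n] and
     [m = n + 1]. *)
  apply: (Yb q e1 _ _ e2 e3); rewrite /r comp_addr comp_mulzr comp_assoc.
  have b1b : b1 < b by lia.
  have hE := hb b1 q0 b1n b1b; rewrite (hom_dE _ _ _ e3 b1m e5 b2m) in hE.
  have fE := congr1 (fun g : cochain X Y (n - 1) => g b q0 bn1) (df0 (int_predK n)).
  rewrite (hom_dE _ _ _ e3 e1 e4 b1n) cochain0E in fE.
  move/eqP: fE; rewrite subr_eq0 => /eqP ->; rewrite -hE.
  rewrite comp_addl comp_oppl comp_mulzl -!comp_assoc cx_dd compm0 mul0rz subr0.
  by rewrite -mulrzDr /s (sgnS e) subrr mulr0z.
exists (patch h t); split=> [p q' ep pb|p q' ep pb]; last by rewrite patch_off //; lia.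
have [q1' [p1 [eq ep1]]] : exists q1' p1, q' + 1 = q1' /\ p1 + 1 = p.
  by exists (q' + 1), (p - 1); lia.
have [Hq1 Hp1] : p + m = q1' /\ p1 + m = q' by lia.
rewrite (hom_dE _ _ _ eq Hq1 ep1 Hp1) (patch_off _ _ _ (p := p1)); last by lia.
have [pE|np] := eqVneq p b; last first.
  rewrite patch_off; last exact/eqP.
  by rewrite -(hom_dE e h ep) hb //; lia.
have [q'E p1E] : q' = q /\ p1 = b1 by lia.
have q1'E : q1' = q1 by lia.
move: ep eq Hq1 ep1 Hp1 {pb}; rewrite pE q'E p1E q1'E => ep eq Hq1 ep1 Hp1.
rewrite patch_at (cx_d_irr Y eq e2) dt /r.
rewrite (cochain_irr f ep e1) (cochain_irr h Hp1 b1m) (cx_d_irr X ep1 e4).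
by rewrite addrK.
Qed.

(** Prescribing [h0] below [b] serves two purposes: with [h0 = 0] the solution inherits the
    vanishing of [f], and with [f = 0], [m = 0] a partial chain map is continued upwards, which
    gives the comparison of resolutions. *)
Lemma extend_null_homotopy (b : int) (h0 : cochain X Y m) :
  (forall (p q : int) (ep : p + n = q), p < b -> hom_d e h0 ep = @f p q ep) ->
  (forall p q : int, b <= p -> p + n = q -> exact_hom (X p) Y q) ->
  exists h, hom_d e h = f /\ forall (p q : int) (ep : p + m = q), p < b -> h p q ep = h0 p q ep.
Proof.
move=> h0b Yex.
have step (k : nat) h : solves (b + k%:Z) h ->
    exists h', solves (b + k.+1%:Z) h' /\ agree (b + k%:Z) h h'.
  move=> hk; have [|h' [h'b h'h]] := extend_null_homotopy_step _ hk.
    by move=> j jE; apply: Yex jE; lia.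
  by exists h'; split=> // p q ep pb; apply: h'b; lia.
have h00 : solves (b + 0%:Z) h0 by move=> p q ep pb; apply: h0b; lia.
pose hs := fix hs (k : nat) : {h | solves (b + k%:Z) h} :=
  match k with
  | 0 => exist _ h0 h00
  | k'.+1 => let: exist h hk := hs k' in
     exist _ (projT1 (cid (step k' h hk))) (projT2 (cid (step k' h hk))).1
  end.
pose g k := sval (hs k).
have gS k : agree (b + k%:Z) (g k) (g k.+1).
  rewrite /g /=; case: (hs k) => h hk /=.
  exact: (projT2 (cid (step k h hk))).2.
have gP k : solves (b + k%:Z) (g k) by rewrite /g; exact: (svalP (hs k)).
have gE k d p q ep : p < b + k%:Z -> g (k + d)%N p q ep = g k p q ep.
  move=> pk; elim: d => [|d IH]; first by rewrite addn0.
  by rewrite addnS gS ?IH //; lia.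
(* Stage [k] is settled strictly below [b + k], so degree [p >= b] is final from stage [p - b + 1]
   on. The solution is read off this diagonal. *)
pose K p : nat := if p < b then 0%N else `|p - b|.+1.
have KP p : p < b + (K p)%:Z by rewrite /K; case: ifP; lia.
exists (fun p q ep => g (K p) p q ep); split=> [|p q ep pb]; last first.
  by rewrite /K pb.
apply: cochainP => p q ep; rewrite -(gP (K p) p q ep (KP p)).
have [q1 [p1 [eq ep1]]] : exists q1 p1, q + 1 = q1 /\ p1 + 1 = p.
  by exists (q + 1), (p - 1); lia.
have [Hq1 Hp1] : p + m = q1 /\ p1 + m = q by lia.
rewrite !(hom_dE _ _ _ eq Hq1 ep1 Hp1); congr (_ - _ ∘ _ *~ _).
(* The equation at [p] also involves the component at [p1 = p - 1], taken from the stage [K p1],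
   which is no later than [K p]; by [gE] the two stages agree there. *)
have -> : K p = (K p1 + (K p - K p1))%N by rewrite /K; case: ifP; case: ifP; lia.
by rewrite gE.
Qed.

End Extension.

Lemma acyclic_bottom (C : additiveCategory) (X Y : complex C) :
  (forall p q, exact_hom (X p) Y q) -> acyclic at_bottom X Y.
Proof.
move=> ex n m e f df [b fb].
have [||h [dh h0]] := @extend_null_homotopy _ X Y n m e f df b 0.
- by move=> p q ep pb; rewrite fb // /hom_d !cochain0E compm0 comp0m mul0rz subrr.
- by [].
by exists h => //; exists b => p pb q ep; rewrite h0.
Qed.

(** * Duality *)

(** Ended by [Defined], so that homs and composites of the opposite category reduce to those of [C]
    and statements pass between the two by conversion. *)
Definition opcat (C : additiveCategory) : additiveCategory.
Proof.
refine (@AdditiveCategory (obj C) (fun A B => hom B A) (fun A => idm A)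
  (fun A B D g f => f ∘ g) _ _ _ _ _ (zobj C) (zobjP C) (fun A B => bip A B)
  (fun A B => pr1 A B) (fun A B => pr2 A B) (fun A B => in1 A B)
  (fun A B => in2 A B) _ _ _ _ _).
- by move=> A B f; apply: comp_idr.
- by move=> A B f; apply: comp_idl.
- by move=> A B D E h g f; rewrite comp_assoc.
- by move=> A B D g g' f; apply: comp_addr.
- by move=> A B D g g' f; apply: comp_addl.
- by move=> A B; apply: pr1_in1.
- by move=> A B; apply: pr2_in2.
- by move=> A B; apply: pr2_in1.
- by move=> A B; apply: pr1_in2.
- by move=> A B; apply: bip_id.
Defined.

Fact opp_succ (i j : int) : j + 1 = i -> - i + 1 = - j.
Proof. lia. Qed.

Program Definition op_complex (C : additiveCategory) (X : complex C) :
    complex (opcat C) :=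
  @Complex (opcat C) (fun p => X (- p)) (fun i j e => cx_d X (opp_succ e)) _.
Next Obligation. by rewrite /= cx_dd. Qed.

Program Definition unop_complex (C : additiveCategory) (X : complex (opcat C)) :
    complex C :=
  @Complex C (fun p => X (- p)) (fun i j e => cx_d X (opp_succ e)) _.
Next Obligation. exact: (cx_dd X). Qed.

(* [op_complex] and [unop_complex] are inverse to each other only up to the
   propositional equality [- - p = p]; both are instances of this relation. *)
Record dual_complexes (C : additiveCategory) (X : complex C)
    (X' : complex (opcat C)) := DualComplexes {
  dual_to : forall p p' : int, p + p' = 0 -> @hom C (X p) (X' p');
  dual_from : forall p p' : int, p + p' = 0 -> @hom C (X' p') (X p);
  dual_toK : forall p p' (e : p + p' = 0),
    dual_from e ∘ dual_to e = idm (X p);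
  dual_fromK : forall p p' (e : p + p' = 0),
    dual_to e ∘ dual_from e = @idm C (X' p');
  dual_d : forall i j (e : j + 1 = i) i' j' (ei : i + i' = 0) (ej : j + j' = 0)
    (e' : i' + 1 = j'),
    dual_to ej ∘ cx_d X e = (cx_d X' e' : @hom C (X' i') (X' j')) ∘ dual_to ei }.

Fact opp_of_sum (p p' : int) : p + p' = 0 -> p = - p'.
Proof. lia. Qed.

Lemma tr_comp (C : additiveCategory) (X : complex C) p q r (e : p = q) (e' : q = r) :
  tr X e' ∘ tr X e = tr X (etrans e e').
Proof. by case: r / e'; rewrite comp_idl. Qed.

Lemma tr_d (C : additiveCategory) (X : complex C) i j i' j' (e : j + 1 = i)
    (e' : j' + 1 = i') (ei : i = i') (ej : j = j') :
  tr X ej ∘ cx_d X e = cx_d X e' ∘ tr X ei.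
Proof.
case: i' / ei e' => e'; case: j' / ej e' => e'.
by rewrite !tr_id comp_idl comp_idr (cx_d_irr X e e').
Qed.

Definition op_complexP (C : additiveCategory) (X : complex C) :
  dual_complexes X (op_complex X).
Proof.
refine (@DualComplexes C X (op_complex X)
  (fun p p' e => tr X (opp_of_sum e)) (fun p p' e => tr X (esym (opp_of_sum e)))
  _ _ _) => [p p' e|p p' e|i j e i' j' ei ej e'].
- by rewrite tr_comp tr_id.
- by rewrite tr_comp tr_id.
- exact: tr_d.
Defined.

Definition unop_complexP (C : additiveCategory) (X' : complex (opcat C)) :
  dual_complexes (unop_complex X') X'.
Proof.
have opp' (p p' : int) : p + p' = 0 -> p' = - p by lia.
refine (@DualComplexes C (unop_complex X') X'
  (fun p p' e => tr X' (opp' p p' e)) (fun p p' e => tr X' (esym (opp' p p' e)))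
  _ _ _) => [p p' e|p p' e|i j e i' j' ei ej e'].
- by rewrite -[LHS]/(@comp (opcat C) _ _ _ _ _) tr_comp tr_id.
- by rewrite -[LHS]/(@comp (opcat C) _ _ _ _ _) tr_comp tr_id.
- exact/esym/(tr_d X').
Defined.

Fact op_cochain_eq (n p q : int) : p + n = q -> - q + n = - p.
Proof. lia. Qed.

Section OppositeCochain.
Variables (C : additiveCategory) (X Y : complex C) (X' Y' : complex (opcat C)).
Variables (dX : dual_complexes X X') (dY : dual_complexes Y Y').

Definition op_cochain n (f : cochain X Y n) : cochain Y' X' n :=
  fun p q e => dual_to dY (addNr p) ∘ f (- q) (- p) (op_cochain_eq e)
    ∘ dual_from dX (addNr q).

Lemma op_cochainE n (f : cochain X Y n) p q (e : p + n = q) p1 q1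
    (ep : p1 + p = 0) (eq : q1 + q = 0) (e1 : q1 + n = p1) :
  op_cochain f e = dual_to dY ep ∘ f q1 p1 e1 ∘ dual_from dX eq.
Proof.
have [p1E q1E] : p1 = - p /\ q1 = - q by lia.
move: ep eq e1; rewrite p1E q1E => ep eq e1; rewrite /op_cochain.
by rewrite (eq_irrelevance ep (addNr p)) (eq_irrelevance eq (addNr q)) (cochain_irr f e1 (op_cochain_eq e)).
Qed.

Definition unop_cochain n (f : cochain Y' X' n) : cochain X Y n :=
  fun p q e => dual_from dY (subrr q) ∘ (f (- q) (- p) (op_cochain_eq e) : @hom C _ _)
    ∘ dual_to dX (subrr p).

Lemma unop_cochainK n (f : cochain Y' X' n) : op_cochain (unop_cochain f) = f.
Proof.
apply: cochainP => p q e.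
have [[p1 ep] [q1 eq]] : (exists p1 : int, p1 + p = 0) /\ (exists q1 : int, q1 + q = 0).
  by split; [exists (- p)|exists (- q)]; lia.
have e1 : q1 + n = p1 by lia.
have [pE qE] : - p1 = p /\ - q1 = q by lia.
rewrite (op_cochainE _ _ ep eq e1) /unop_cochain.
move: (subrr p1) (subrr q1) (op_cochain_eq e1); rewrite pE qE => ep' eq' e'.
rewrite (eq_irrelevance ep' ep) (eq_irrelevance eq' eq) (eq_irrelevance e' e).
by rewrite !comp_assoc dual_fromK comp_idl -comp_assoc dual_fromK comp_idr.
Qed.

Lemma op_cochainB n (f g : cochain X Y n) :
  op_cochain (f - g) = op_cochain f - op_cochain g.
Proof.
apply: cochainP => p q e; rewrite [RHS]cochainBE /op_cochain cochainBE.
by rewrite comp_addr comp_oppr comp_addl comp_oppl.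
Qed.

Lemma op_cochainD n (f g : cochain X Y n) :
  op_cochain (f + g) = op_cochain f + op_cochain g.
Proof.
apply: cochainP => p q e; rewrite [RHS]cochainDE /op_cochain cochainDE.
by rewrite comp_addr comp_addl.
Qed.

Lemma op_cochainMz n (f : cochain X Y n) (k : int) :
  op_cochain (f *~ k) = op_cochain f *~ k.
Proof.
apply: cochainP => p q e; rewrite [RHS]cochainMzE /op_cochain cochainMzE.
by rewrite comp_mulzr comp_mulzl.
Qed.

(** Dualising exchanges the two terms of the differential. [op_cochain] has no sign built in, so it
    commutes with differentials only up to a unit, which affects neither cycles nor boundaries. *)
Lemma op_cochain_d n m (e : n + 1 = m) (f : cochain X Y m) :
  hom_d e (op_cochain f) = - (op_cochain (hom_d e f) *~ ((-1) ^ m)).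
Proof.
apply: cochainP => p q e'; rewrite [RHS]cochainNE cochainMzE.
have [q1 [p1 [p' [q' [q1' [p1' [[e1 e2 e3 e4] [e5 e6]]]]]]]] :
  exists q1 p1 p' q' q1' p1', [/\ q + 1 = q1, p1 + 1 = p, p' + p = 0 & q' + q = 0]
   /\ (q1' + q1 = 0 /\ p1' + p1 = 0).
  exists (q + 1), (p - 1), (- p), (- q), (- q - 1), (- p + 1); split; split; lia.
have [h1 h2 h3 h4] : [/\ p + m = q1, p1 + m = q, p' + 1 = p1' & q1' + 1 = q'] by split; lia.
have [k1 k2 k3] : [/\ q1' + m = p', q' + m = p1' & q' + n = p'] by split; lia.
rewrite (hom_dE _ _ _ e1 h1 e2 h2) (op_cochainE _ _ e3 e5 k1) (op_cochainE _ _ e6 e4 k2).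
rewrite (op_cochainE _ _ e3 e4 k3) (hom_dE _ _ _ h3 k2 h4 k1).
rewrite comp_addr comp_oppr comp_mulzr comp_addl comp_oppl comp_mulzl.
have dXE : cx_d X h4 ∘ dual_from dX e4 = dual_from dX e5 ∘ (cx_d X' e1 : @hom C _ _).
  have := dual_d dX h4 e4 e5 e1 => E.
  rewrite -[cx_d X h4]comp_idl -(dual_toK dX e5) -(comp_assoc (dual_from dX e5)) E.
  by rewrite -!comp_assoc dual_fromK comp_idr.
have dYE := dual_d dY h3 e6 e3 e2.
rewrite !comp_assoc dYE -(comp_assoc _ (cx_d X h4)) dXE.
rewrite mulrzBl -mulrzA sgn2 mulr1z opprB /=.
by rewrite !comp_assoc.
Qed.

Variables (F F' : tail).
Hypothesis FF' : forall P : int -> Prop, F' P <-> F (fun p => P (- p)).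

(** Source degree [p] of the dual cochain is target degree [- p] of [f], hence source degree
    [- p - n]: reflection of the tail plus a shift. *)
Lemma op_cochain_ev n (f : cochain X Y n) :
  eventually F' (op_cochain f) <-> eventually F f.
Proof.
split.
  move/FF' => Ff; apply: (tail_sub (tail_shift n Ff)) => p fp q e.
  have [q1 eq1] : exists q1 : int, p + q1 = 0 by exists (- p); lia.
  have [p1 ep1] : exists p1 : int, q + p1 = 0 by exists (- q); lia.
  have e1 : p1 + n = q1 by lia.
  have p1E : - (p + n) = p1 by lia.
  move: fp; rewrite p1E => /(_ _ e1); rewrite (op_cochainE f e1 ep1 eq1 e) => f0.
  rewrite -[f p q e]comp_idl -[f p q e]comp_idr -(dual_toK dX eq1) -(dual_toK dY ep1).
  move/(congr1 (fun g => dual_from dY ep1 ∘ g ∘ dual_to dX eq1)): f0.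
  by rewrite compm0 comp0m !comp_assoc.
move=> Ff; apply/FF'; apply: (tail_sub (tail_shift (- n) Ff)) => p fp q e.
have eq : p - n + q = 0 by lia.
rewrite (op_cochainE f e (subrr p) eq (subrK n p)) fp.
by rewrite compm0 comp0m.
Qed.

Lemma tail_homology_op n :
  ab_isomorphic (tail_homology F X Y n) (tail_homology F' Y' X' n).
Proof.
apply: (@tail_homology_iso _ _ _ _ _ _ _ _ _ _ (@op_cochain n)).
- exact: op_cochainB.
- move=> x Zx m e; rewrite op_cochain_d; apply/eventuallyN/eventuallyMz.
  exact/op_cochain_ev.
- move=> x _ [m [e [g Fg]]].
  rewrite -(subrK (hom_d e g) x).
  have -> : op_cochain (x - hom_d e g + hom_d e g) =
      op_cochain (x - hom_d e g) - hom_d e (op_cochain g) *~ ((-1) ^ m).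
    rewrite op_cochain_d mulNrz -mulrzA sgn2 mulr1z opprK.
    by rewrite op_cochainB !subrK.
  apply: tail_boundaryB; first exact/tail_boundary_ev/op_cochain_ev.
  exact/tail_boundaryMz/tail_boundary_d.
- move=> x _ [m [e [g]]].
  rewrite -(unop_cochainK g) op_cochain_d -op_cochainMz opprK.
  rewrite -op_cochainD => /op_cochain_ev Fg.
  exists m, e, (- (unop_cochain g *~ ((-1) ^ m))).
  have -> : hom_d e (- (unop_cochain g *~ ((-1) ^ m))) =
      - (hom_d e (unop_cochain g) *~ ((-1) ^ m)) by rewrite -raddfMz -raddfN.
  by rewrite opprK.
- move=> y Zy; exists (unop_cochain y); rewrite unop_cochainK subrr; split; last first.
    exact/tail_boundary_ev/eventually0.
  move=> m e; apply/op_cochain_ev.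
  have := Zy _ e; rewrite -{1}(unop_cochainK y) op_cochain_d.
  move=> /(eventuallyMz (- (-1) ^ n)); rewrite mulrNz mulNrz opprK.
  by rewrite -mulrzA sgn2 mulr1z.
Qed.

End OppositeCochain.

(** * Resolutions *)

Definition coexact_hom (C : additiveCategory) (W : C) (X : complex C) (j : int) : Prop :=
  forall (i k : int) (ei : j + 1 = i) (ek : k + 1 = j) (r : hom (X j) W),
    r ∘ cx_d X ei = 0 -> exists t, t ∘ cx_d X ek = r.

Lemma op_exact_hom (C : additiveCategory) (W : C) (X : complex C) j :
  coexact_hom W X (- j) -> exact_hom (C := opcat C) W (op_complex X) j.
Proof.
move=> ex i k ei ek r r0.
have [t ht] := ex _ _ (opp_succ ek) (opp_succ ei) r r0.
by exists t.
Qed.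

Lemma everywhere_opp (P : int -> Prop) :
  everywhere P <-> everywhere (fun p => P (- p)).
Proof. by split=> Pp p; [exact: Pp|rewrite -(opprK p); apply: Pp]. Qed.

Lemma acyclic_op (C : additiveCategory) (X Y : complex C) (X' Y' : complex (opcat C))
    (F F' : tail) : dual_complexes X X' -> dual_complexes Y Y' ->
  (forall P : int -> Prop, F' P <-> F (fun p => P (- p))) ->
  acyclic F' Y' X' -> acyclic F X Y.
Proof.
move=> dX dY FF' ac n m e f df Ff.
have dop k (ek : k + 1 = n) : hom_d ek (op_cochain dX dY f) = 0.
  rewrite op_cochain_d df.
  have -> : op_cochain dX dY (0 : cochain X Y k) = 0.
    by apply: cochainP => p q ep; rewrite /op_cochain !cochain0E compm0 comp0m.
  by rewrite mul0rz oppr0.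
have [h Fh dh] := ac n m e _ dop ((op_cochain_ev dX dY FF' f).2 Ff).
pose g := unop_cochain dX dY h.
have gh : op_cochain dX dY g = h by exact: unop_cochainK.
exists (- (g *~ (-1) ^ m)).
  by apply/eventuallyN/eventuallyMz/(op_cochain_ev dX dY FF'); rewrite gh.
have -> : hom_d e (- (g *~ (-1) ^ m)) = - (hom_d e g *~ (-1) ^ m).
  by rewrite -raddfMz -raddfN.
apply/eqP; rewrite -subr_eq0; apply/eqP; apply: cochainP.
(* For the trivial tail, [op_cochain_ev] says that [op_cochain] is injective, so the equation may be
   checked after dualising. *)
apply/(op_cochain_ev dX dY everywhere_opp); rewrite op_cochainB -dh -gh op_cochain_d.
have -> : op_cochain dX dY (- (hom_d e g *~ (-1) ^ m)) =
    - (op_cochain dX dY (hom_d e g) *~ (-1) ^ m).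
  by rewrite -!mulrNz op_cochainMz.
by rewrite subrr => p q ep.
Qed.

Lemma at_bottom_opp (P : int -> Prop) : at_bottom P <-> at_top (fun p => P (- p)).
Proof.
split=> [[b Pb]|[b Pb]]; exists (- b) => p pb; first by apply: Pb; lia.
by rewrite -(opprK p); apply: Pb; lia.
Qed.

Lemma at_top_opp (P : int -> Prop) : at_top P <-> at_bottom (fun p => P (- p)).
Proof.
split=> [[b Pb]|[b Pb]]; exists (- b) => p pb; first by apply: Pb; lia.
by rewrite -(opprK p); apply: Pb; lia.
Qed.

Lemma acyclic_top (C : additiveCategory) (X Y : complex C) :
  (forall p q, coexact_hom (Y q) X p) -> acyclic at_top X Y.
Proof.
move=> ex; apply: (acyclic_op (op_complexP X) (op_complexP Y) at_bottom_opp).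
by apply: acyclic_bottom => p q; apply: op_exact_hom; apply: ex.
Qed.

Section ZeroObjects.
Variable C : additiveCategory.
Implicit Types A B : C.

Lemma from_zero A B (f : hom A B) : is_zero_obj A -> f = 0.
Proof. by move=> A0; rewrite -[f]comp_idr A0 compm0. Qed.

Lemma to_zero A B (f : hom A B) : is_zero_obj B -> f = 0.
Proof. by move=> B0; rewrite -[f]comp_idl B0 comp0m. Qed.

End ZeroObjects.

Definition chain_map (C : additiveCategory) (X Y : complex C) (u : cochain X Y 0) : Prop :=
  tail_cycle everywhere u.

Section DegreeZero.
Variable C : additiveCategory.
Implicit Types X Y : complex C.

Definition diag X Y (w : forall p, hom (X p) (Y p)) : cochain X Y 0 :=
  fun p q e => id_cochain Y e ∘ w p.

Lemma diag_at X Y (w : forall p, hom (X p) (Y p)) p (e : p + 0 = p) :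
  diag w e = w p.
Proof. by rewrite /diag id_cochain_id comp_idl. Qed.

Lemma degree0_eq0 X Y (u : cochain X Y 0) p q (e : p + 0 = q) :
  u p p (addr0 p) = 0 -> u p q e = 0.
Proof.
have E : q = p by lia.
by move: e; rewrite E => e; rewrite (eq_irrelevance e (addr0 p)).
Qed.

Lemma tail_cycle0P (F : tail) X Y (u : cochain X Y 0) :
  tail_cycle F u <-> F (fun p => forall q (e : q + 1 = p),
    cx_d Y e ∘ u p p (addr0 p) = u q q (addr0 q) ∘ cx_d X e).
Proof.
split=> [Zu|Fu].
  apply: (tail_sub (Zu (-1) erefl)) => p up q e.
  have e1 : p + -1 = q by lia.
  have := up q e1; rewrite (hom_dE _ _ _ e (addr0 p) e (addr0 q)) expr0z mulr1z.
  by move/eqP; rewrite subr_eq0 => /eqP.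
move=> m em; apply: (tail_sub Fu) => p up q e.
have e1 : q + 1 = p by lia.
rewrite (hom_dE _ _ _ e1 (addr0 p) e1 (addr0 q)) expr0z mulr1z.
by apply/eqP; rewrite subr_eq0; apply/eqP/up.
Qed.

Lemma chain_mapE X Y (u : cochain X Y 0) p q p' q' (ep : p + 0 = p') (eq : q + 0 = q')
    (e : q + 1 = p) (e' : q' + 1 = p') : chain_map u ->
  cx_d Y e' ∘ u p p' ep = u q q' eq ∘ cx_d X e.
Proof.
move=> /tail_cycle0P cu; have [p'E q'E] : p' = p /\ q' = q by lia.
move: ep eq e'; rewrite p'E q'E => ep eq e'.
rewrite (cochain_irr u ep (addr0 p)) (cochain_irr u eq (addr0 q)) (eq_irrelevance e' e).
exact: cu.
Qed.

Lemma tail_cycle_chain (F : tail) X Y (u : cochain X Y 0) :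
  chain_map u -> tail_cycle F u.
Proof. by move=> /tail_cycle0P cu; apply/tail_cycle0P/tail_all. Qed.

Lemma comp0_at X Y Z (u : cochain Y Z 0) (v : cochain X Y 0) p :
  comp_cochain (addr0 0) u v (addr0 p) = u p p (addr0 p) ∘ v p p (addr0 p).
Proof. exact: comp_cochainE. Qed.

End DegreeZero.

Section Resolutions.
Variables (C : additiveCategory) (Pr : C -> Prop).

(* Nothing is required of [P] in negative degrees. *)
Record augmented (M : C) (P : complex C) (eps : hom (P 0) M) : Prop := Augmented {
  aug_d : forall i (e : 0 + 1 = i), eps ∘ cx_d P e = 0;
  aug_onto : forall Q (f : hom Q M), Pr Q -> exists t, eps ∘ t = f;
  aug_exact0 : forall Q i (e : 0 + 1 = i) (r : hom Q (P 0)), Pr Q ->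
    eps ∘ r = 0 -> exists t, cx_d P e ∘ t = r;
  aug_exact : forall Q j, Pr Q -> 0 < j -> exact_hom Q P j }.

Record resolution (M : C) (P : complex C) (eps : hom (P 0) M) : Prop := Resolution {
  res_zero : forall p, p < 0 -> is_zero_obj (P p);
  res_Pr : forall p, Pr (P p);
  res_aug : augmented eps }.

Variables (M M' : C) (P P' : complex C).
Variables (eps : hom (P 0) M) (eps' : hom (P' 0) M').
Hypotheses (resP : resolution eps) (resP' : resolution eps').

(** The extension lemma takes over at source degree 2, where exactness is needed only in positive
    degrees. Degrees 0 and 1 involve the augmentation and are filled in by hand. *)
Lemma resolution_lift (f : hom M M') : exists u : cochain P P' 0,
  chain_map u /\ eps' ∘ u 0 0 (addr0 0) = f ∘ eps.
Proof.
have [u0 hu0] := aug_onto (res_aug resP') (f ∘ eps) (res_Pr resP 0).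
have e01 : 0 + 1 = 1 :> int by [].
have [u1 hu1] : exists t, cx_d P' e01 ∘ t = u0 ∘ cx_d P e01.
  apply: (aug_exact0 (res_aug resP') _ (res_Pr resP 1)).
  by rewrite comp_assoc hu0 -comp_assoc (aug_d (res_aug resP)) compm0.
have e0 : -1 + 1 = 0 :> int by [].
pose h0 := patch (patch (0 : cochain P P' 0) u0) u1.
have [|||h [dh hh0]] := @extend_null_homotopy _ P P' (-1) 0 e0 0 _ 2 h0.
- by move=> k ek; apply: raddf0.
- move=> p q ep p2; rewrite cochain0E.
  have [p0|p0] := ltP p 0; first exact/from_zero/(res_zero resP).
  have [pE|np] := eqVneq p 0; first by apply/to_zero/(res_zero resP'); lia.
  have [pE qE] : p = 1 /\ q = 0 by lia.
  move: ep; rewrite pE qE => ep.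
  rewrite (hom_dE e0 h0 ep e01 (addr0 1) e01 (addr0 0)) /h0 patch_at patch_off //.
  by rewrite patch_at expr0z mulr1z hu1 subrr.
- move=> p q p2 ep; apply: (aug_exact (res_aug resP') (res_Pr resP p)).
  lia.
exists h; split; last by rewrite hh0 // /h0 patch_off // patch_at.
by apply: (tail_cycle_ex (e := e0)); rewrite dh; apply: eventually0.
Qed.

Lemma resolution_lift_unique (u : cochain P P' 0) : chain_map u ->
  eps' ∘ u 0 0 (addr0 0) = 0 -> exists h, hom_d (add0r 1) h = u.
Proof.
move=> cu u0.
have e01 : 0 + 1 = 1 :> int by [].
have [t ht] := aug_exact0 (res_aug resP') e01 (res_Pr resP 0) u0.
have [|||h [dh _]] := @extend_null_homotopy _ P P' 0 1 (add0r 1) u _ 1 (patch 0 t).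
- by move=> k ek; apply: cochainP => p q ep; apply: (cu k ek p q ep).
- move=> p q ep p1.
  have [p0|p0] := ltP p 0; first by have P0 := res_zero resP p0; rewrite (from_zero (hom_d _ _ _) P0) (from_zero (u p q ep) P0).
  have [pE qE] : p = 0 /\ q = 0 by lia.
  move: ep; rewrite pE qE => ep; have e0 : -1 + 1 = 0 :> int by [].
  rewrite (hom_dE _ _ ep e01 e01 e0 e0) patch_at patch_off //.
  by rewrite comp0m mul0rz subr0 ht (cochain_irr u ep (addr0 0)).
- move=> p q p1 ep; apply: (aug_exact (res_aug resP') (res_Pr resP p)).
  lia.
by exists h.
Qed.

End Resolutions.

Lemma tail_homology_resolution (C : additiveCategory) (Pr : C -> Prop) (F : tail) (M : C)
    (P P' Y : complex C) (eps : hom (P 0) M) (eps' : hom (P' 0) M) n :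
  resolution Pr eps -> resolution Pr eps' ->
  ab_isomorphic (tail_homology F P Y n) (tail_homology F P' Y n).
Proof.
move=> resP resP'.
have [u [cu eu]] := resolution_lift resP' resP (idm M).
have [v [cv ev]] := resolution_lift resP resP' (idm M).
have null (Q Q' : complex C) (eta : hom (Q 0) M) (eta' : hom (Q' 0) M)
    (a : cochain Q Q' 0) (b : cochain Q' Q 0) :
    resolution Pr eta -> chain_map a -> chain_map b ->
    eta' ∘ a 0 0 (addr0 0) = idm M ∘ eta -> eta ∘ b 0 0 (addr0 0) = idm M ∘ eta' ->
    tail_boundary F (comp_cochain (addr0 0) b a - id_cochain Q).
  move=> resQ ca cb ea eb.
  have cid : chain_map (id_cochain Q).
    by apply/tail_cycle0P => p q e; rewrite !id_cochain_id comp_idl comp_idr.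
  have cba : chain_map (comp_cochain (addr0 0) b a - id_cochain Q).
    move=> m em; have -> : hom_d em (comp_cochain (addr0 0) b a - id_cochain Q) =
      hom_d em (comp_cochain (addr0 0) b a) - hom_d em (id_cochain Q) by exact: raddfB.
    by apply: eventuallyB; [exact: tail_cycle_comp|exact: cid].
  have [|h <-] := resolution_lift_unique resQ resQ cba; last exact: tail_boundary_d.
  rewrite cochainBE comp0_at id_cochain_id comp_addr comp_oppr comp_assoc eb.
  by rewrite comp_idl ea comp_idl comp_idr subrr.
apply: (@tail_homology_precomp _ _ P P' Y n u v); try exact: tail_cycle_chain.
- exact: null resP' _ _ eu ev.
- exact: null resP _ _ ev eu.
Qed.

(** * Mapping cones *)

Section Biproducts.
Variable C : additiveCategory.
Implicit Types A B D : C.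

Lemma pr1_in1_comp A B D (f : hom D A) : pr1 A B ∘ (in1 A B ∘ f) = f.
Proof. by rewrite comp_assoc pr1_in1 comp_idl. Qed.

Lemma pr2_in2_comp A B D (f : hom D B) : pr2 A B ∘ (in2 A B ∘ f) = f.
Proof. by rewrite comp_assoc pr2_in2 comp_idl. Qed.

Lemma pr1_in2_comp A B D (f : hom D B) : pr1 A B ∘ (in2 A B ∘ f) = 0.
Proof. by rewrite comp_assoc pr1_in2 comp0m. Qed.

Lemma pr2_in1_comp A B D (f : hom D A) : pr2 A B ∘ (in1 A B ∘ f) = 0.
Proof. by rewrite comp_assoc pr2_in1 comp0m. Qed.

Definition pr_in_comp := (pr1_in1_comp, pr2_in2_comp, pr1_in2_comp, pr2_in1_comp).

Lemma to_bip_eq A B D (f g : hom D (bip A B)) :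
  pr1 A B ∘ f = pr1 A B ∘ g -> pr2 A B ∘ f = pr2 A B ∘ g -> f = g.
Proof.
move=> fg1 fg2; rewrite -[f]comp_idl -[g]comp_idl -bip_id !comp_addl.
by rewrite -!comp_assoc fg1 fg2.
Qed.

Lemma from_bip_eq A B D (f g : hom (bip A B) D) :
  f ∘ in1 A B = g ∘ in1 A B -> f ∘ in2 A B = g ∘ in2 A B -> f = g.
Proof.
move=> fg1 fg2; rewrite -[f]comp_idr -[g]comp_idr -bip_id !comp_addr.
by rewrite !comp_assoc fg1 fg2.
Qed.

Lemma pr1_hom_sum A B A' B' (f : hom A B) (f' : hom A' B') :
  pr1 B B' ∘ hom_sum f f' = f ∘ pr1 A A'.
Proof. by rewrite /hom_sum comp_addr -!comp_assoc !pr_in_comp addr0. Qed.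

Lemma pr2_hom_sum A B A' B' (f : hom A B) (f' : hom A' B') :
  pr2 B B' ∘ hom_sum f f' = f' ∘ pr2 A A'.
Proof. by rewrite /hom_sum comp_addr -!comp_assoc !pr_in_comp add0r. Qed.

End Biproducts.

Section Cone.
Variables (C : additiveCategory) (X Y : complex C) (c : cochain X Y 0).

Fact cone_eq1 (i j : int) : j + 1 = i -> i - 1 + 0 = j.
Proof. lia. Qed.
Fact cone_eq2 (i j : int) : j + 1 = i -> j - 1 + 1 = i - 1.
Proof. lia. Qed.

Definition cone_d (i j : int) (e : j + 1 = i) :
    hom (bip (Y i) (X (i - 1))) (bip (Y j) (X (j - 1))) :=
  in1 _ _ ∘ (cx_d Y e ∘ pr1 _ _ + c (cone_eq1 e) ∘ pr2 _ _)
  - in2 _ _ ∘ (cx_d X (cone_eq2 e) ∘ pr2 _ _).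

Lemma pr1_cone_d i j (e : j + 1 = i) (e1 : i - 1 + 0 = j) :
  pr1 _ _ ∘ cone_d e = cx_d Y e ∘ pr1 _ _ + c e1 ∘ pr2 _ _.
Proof.
rewrite /cone_d comp_addr comp_oppr !pr_in_comp oppr0 addr0.
by rewrite (cochain_irr c e1 (cone_eq1 e)).
Qed.

Lemma pr2_cone_d i j (e : j + 1 = i) (e2 : j - 1 + 1 = i - 1) :
  pr2 _ _ ∘ cone_d e = - (cx_d X e2 ∘ pr2 _ _).
Proof.
rewrite /cone_d comp_addr comp_oppr !pr_in_comp add0r.
by rewrite (cx_d_irr X e2 (cone_eq2 e)).
Qed.

Hypothesis cc : chain_map c.

Fact cone_dd i j k (e : j + 1 = i) (e' : k + 1 = j) : cone_d e' ∘ cone_d e = 0.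
Proof.
apply: to_bip_eq; rewrite compm0 comp_assoc.
  rewrite (pr1_cone_d e' (cone_eq1 e')) comp_addl -!comp_assoc.
  rewrite (pr1_cone_d e (cone_eq1 e)) (pr2_cone_d e (cone_eq2 e)).
  rewrite comp_addr comp_oppr !comp_assoc cx_dd comp0m add0r.
  by rewrite (chain_mapE _ (cone_eq1 e') (cone_eq2 e)) // subrr.
rewrite (pr2_cone_d e' (cone_eq2 e')) comp_oppl -comp_assoc.
by rewrite (pr2_cone_d e (cone_eq2 e)) comp_oppr comp_assoc cx_dd comp0m !oppr0.
Qed.

Definition cone : complex C :=
  @Complex C (fun p => bip (Y p) (X (p - 1))) cone_d cone_dd.

Lemma pr1_cone Q i j (e : j + 1 = i) (e1 : i - 1 + 0 = j) (r : hom Q (cone i)) :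
  pr1 (Y j) (X (j - 1)) ∘ (cx_d cone e ∘ r)
    = cx_d Y e ∘ (pr1 (Y i) (X (i - 1)) ∘ r) + c e1 ∘ (pr2 (Y i) (X (i - 1)) ∘ r).
Proof.
rewrite -[LHS]/(pr1 _ _ ∘ (cone_d e ∘ r)) comp_assoc (pr1_cone_d e e1).
by rewrite comp_addl -!comp_assoc.
Qed.

Lemma pr2_cone Q i j (e : j + 1 = i) (e2 : j - 1 + 1 = i - 1) (r : hom Q (cone i)) :
  pr2 (Y j) (X (j - 1)) ∘ (cx_d cone e ∘ r)
    = - (cx_d X e2 ∘ (pr2 (Y i) (X (i - 1)) ∘ r)).
Proof.
rewrite -[LHS]/(pr2 _ _ ∘ (cone_d e ∘ r)) comp_assoc (pr2_cone_d e e2).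
by rewrite comp_oppl -!comp_assoc.
Qed.

Lemma cone_in1 i j (e : j + 1 = i) :
  cx_d cone e ∘ in1 (Y i) (X (i - 1)) = in1 (Y j) (X (j - 1)) ∘ cx_d Y e.
Proof.
apply: to_bip_eq; rewrite pr_in_comp.
  apply: etrans (pr1_cone _ (cone_eq1 e) _) _.
  by rewrite pr1_in1 pr2_in1 compm0 addr0 comp_idr.
apply: etrans (pr2_cone _ (cone_eq2 e) _) _.
by rewrite pr2_in1 compm0 oppr0.
Qed.

Lemma cone_in2 i j (e : j + 1 = i) (e1 : i - 1 + 0 = j) (e2 : j - 1 + 1 = i - 1) :
  cx_d cone e ∘ in2 (Y i) (X (i - 1))
    = in1 (Y j) (X (j - 1)) ∘ c e1 - in2 (Y j) (X (j - 1)) ∘ cx_d X e2.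
Proof.
apply: to_bip_eq; rewrite comp_addr comp_oppr !pr_in_comp.
  apply: etrans (pr1_cone _ e1 _) _.
  by rewrite pr1_in2 pr2_in2 compm0 add0r comp_idr subr0.
apply: etrans (pr2_cone _ e2 _) _.
by rewrite pr2_in2 comp_idr sub0r.
Qed.

Lemma cone_cycle Q i j (e : j + 1 = i) (e1 : i - 1 + 0 = j) (e2 : j - 1 + 1 = i - 1)
    (r : hom Q (cone i)) : cx_d cone e ∘ r = 0 ->
  cx_d Y e ∘ (pr1 (Y i) (X (i - 1)) ∘ r) + c e1 ∘ (pr2 (Y i) (X (i - 1)) ∘ r) = 0
    /\ cx_d X e2 ∘ (pr2 (Y i) (X (i - 1)) ∘ r) = 0.
Proof.
move=> r0; split; first by rewrite -pr1_cone r0 compm0.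
by apply/eqP; rewrite -oppr_eq0 -pr2_cone r0 compm0.
Qed.

Lemma cone_boundary Q i j (e : j + 1 = i) (e1 : i - 1 + 0 = j) (e2 : j - 1 + 1 = i - 1)
    (r : hom Q (cone j)) (t1 : hom Q (Y i)) (t2 : hom Q (X (i - 1))) :
  cx_d Y e ∘ t1 + c e1 ∘ t2 = pr1 (Y j) (X (j - 1)) ∘ r ->
  cx_d X e2 ∘ t2 = - (pr2 (Y j) (X (j - 1)) ∘ r) ->
  exists t, cx_d cone e ∘ t = r.
Proof.
move=> h1 h2; exists (in1 _ _ ∘ t1 + in2 _ _ ∘ t2).
apply: to_bip_eq.
  apply: etrans (pr1_cone _ e1 _) _.
  by rewrite -h1 !comp_addr !pr_in_comp !compm0 addr0 add0r.
apply: etrans (pr2_cone _ e2 _) _.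
by rewrite !comp_addr !pr_in_comp compm0 add0r h2 opprK.
Qed.

(** First factor the restriction of [r] to [Y], giving [t1]. The defect of [t1] on the other
    summand, [t1 ∘ c - r ∘ in2], kills the boundaries of [X] because [c] is a chain map, and so it
    factors as well. *)
Lemma cone_coexact W j : coexact_hom W Y j -> coexact_hom W X (j - 1) ->
  coexact_hom W cone j.
Proof.
move=> exY exX i k ei ek r r0.
have e1 := cone_eq1 ei; have e2 := cone_eq2 ei.
have e1' := cone_eq1 ek; have e2' := cone_eq2 ek.
have h1 : (r ∘ in1 (Y j) (X (j - 1))) ∘ cx_d Y ei = 0.
  by rewrite -comp_assoc -cone_in1 comp_assoc r0 comp0m.
have h2 : (r ∘ in2 (Y j) (X (j - 1))) ∘ cx_d X e2 = (r ∘ in1 (Y j) (X (j - 1))) ∘ c e1.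
  apply/eqP; rewrite eq_sym -subr_eq0 -!comp_assoc -comp_oppr -comp_addr.
  by rewrite -cone_in2 comp_assoc r0 comp0m.
have [t1 ht1] := exY _ _ ei ek _ h1.
have [t2 ht2] : exists t2, t2 ∘ cx_d X e2' = t1 ∘ c e1' - r ∘ in2 (Y j) (X (j - 1)).
  apply: (exX _ _ e2 e2'); rewrite comp_addl comp_oppl h2 -ht1.
  by rewrite -!comp_assoc (chain_mapE e1 e1' e2 ek) // subrr.
exists (t1 ∘ pr1 _ _ + t2 ∘ pr2 _ _); apply: from_bip_eq.
  rewrite -comp_assoc cone_in1 comp_assoc comp_addl -!(comp_assoc _ _ (in1 _ _)).
  by rewrite pr1_in1 pr2_in1 compm0 addr0 comp_idr.
rewrite -comp_assoc (cone_in2 _ e1' e2') comp_addr comp_oppr !comp_assoc.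
rewrite !comp_addl -!(comp_assoc _ _ (in1 _ _)) -!(comp_assoc _ _ (in2 _ _)).
rewrite pr1_in1 pr2_in1 pr1_in2 pr2_in2 !compm0 !comp0m addr0 add0r !comp_idr ht2.
by rewrite opprB addrCA subrr addr0.
Qed.

End Cone.

Section ConeMap.
Variables (C : additiveCategory) (X Y X' Y' : complex C).
Variables (c : cochain X Y 0) (c' : cochain X' Y' 0).
Hypotheses (cc : chain_map c) (cc' : chain_map c').
Variable F : tail.

Definition cone_map (b : cochain Y Y' 0) (a : cochain X X' 0) :
    cochain (cone cc) (cone cc') 0 :=
  @diag C (cone cc) (cone cc')
    (fun p => hom_sum (b p p (addr0 p)) (a (p - 1) (p - 1) (addr0 (p - 1)))).

(** The square commutes strictly near the end, not just up to homotopy, so the diagonal map needs no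
    off-diagonal correction. *)
Lemma cone_map_cycle b a : tail_cycle F b -> tail_cycle F a ->
  eventually F (comp_cochain (addr0 0) b c - comp_cochain (addr0 0) c' a) ->
  tail_cycle F (cone_map b a).
Proof.
move=> /tail_cycle0P Zb /tail_cycle0P Za Fca; apply/tail_cycle0P.
have Fp := tail_sub2 (tail_shift (-1) Fca) (tail_shift (-1) Za) (fun p x y => conj x y).
apply: (tail_sub2 Fp Zb) => p [ca ap] bp q e.
rewrite /cone_map !diag_at; have e1 := cone_eq1 e; have e2 := cone_eq2 e.
apply: to_bip_eq.
  apply: etrans (pr1_cone _ e1 _) _; rewrite pr1_hom_sum pr2_hom_sum.
  rewrite [RHS]comp_assoc pr1_hom_sum -[RHS]comp_assoc.
  apply: etrans _ (esym (congr1 (fun g => b _ _ _ ∘ g) (pr1_cone_d c e e1))).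
  rewrite comp_addr !comp_assoc bp; congr (_ + _ ∘ _); apply/esym/eqP.
  rewrite -subr_eq0; have := ca q e1; rewrite cochainBE => <-.
  by rewrite (comp_cochainE _ _ _ _ e1 (addr0 q)) (comp_cochainE _ _ _ _ (addr0 (p - 1)) e1).
apply: etrans (pr2_cone _ e2 _) _; rewrite pr2_hom_sum.
rewrite [RHS]comp_assoc pr2_hom_sum -[RHS]comp_assoc.
apply: etrans _ (esym (congr1 (fun g => a _ _ _ ∘ g) (pr2_cone_d c e e2))).
by rewrite comp_oppr !comp_assoc ap.
Qed.

End ConeMap.

Lemma cone_map_inverse (C : additiveCategory) (X Y X' Y' : complex C)
    (c : cochain X Y 0) (c' : cochain X' Y' 0) (cc : chain_map c) (cc' : chain_map c')
    (F : tail) (b : cochain Y Y' 0) (a : cochain X X' 0)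
    (b' : cochain Y' Y 0) (a' : cochain X' X 0) :
  eventually F (comp_cochain (addr0 0) b' b - id_cochain Y) ->
  eventually F (comp_cochain (addr0 0) a' a - id_cochain X) ->
  eventually F (comp_cochain (addr0 0) (cone_map cc' cc b' a') (cone_map cc cc' b a)
    - id_cochain (cone cc)).
Proof.
move=> Fb Fa; apply: (tail_sub2 Fb (tail_shift (-1) Fa)) => p bp ap q e.
apply: degree0_eq0; rewrite cochainBE comp0_at /cone_map !diag_at id_cochain_id.
apply/eqP; rewrite subr_eq0; apply/eqP.
have := bp p (addr0 p); rewrite cochainBE comp0_at id_cochain_id => /eqP.
rewrite subr_eq0 => /eqP bE.
have := ap _ (addr0 (p - 1)); rewrite cochainBE comp0_at id_cochain_id => /eqP.
rewrite subr_eq0 => /eqP aE.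
apply: to_bip_eq; rewrite comp_assoc ?pr1_hom_sum ?pr2_hom_sum -comp_assoc.
  by rewrite pr1_hom_sum comp_assoc bE comp_idl comp_idr.
by rewrite pr2_hom_sum comp_assoc aE comp_idl comp_idr.
Qed.

(** * Complete resolutions *)

Section Truncation.
Variables (C : additiveCategory) (T : complex C).

Definition trunc_obj (p : int) : C := if 0 <= p then T p else zobj C.

Definition trunc_in (p : int) : hom (trunc_obj p) (T p) :=
  (if 0 <= p as b return hom (if b then T p else zobj C) (T p) then idm (T p) else 0).

Definition trunc_pr (p : int) : hom (T p) (trunc_obj p) :=
  (if 0 <= p as b return hom (T p) (if b then T p else zobj C) then idm (T p) else 0).

Lemma trunc_inK p : trunc_pr p ∘ trunc_in p = idm (trunc_obj p).
Proof.
rewrite /trunc_in /trunc_pr /trunc_obj; case: (0 <= p); first exact: comp_idl.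
by rewrite comp0m zobjP.
Qed.

Lemma trunc_prK p : 0 <= p -> trunc_in p ∘ trunc_pr p = idm (T p).
Proof.
by rewrite /trunc_in /trunc_pr /trunc_obj; case: (0 <= p) => // _; apply: comp_idl.
Qed.

Lemma trunc_zero p : p < 0 -> is_zero_obj (trunc_obj p).
Proof. by rewrite /trunc_obj ltNge => /negbTE ->; apply: zobjP. Qed.

Fact trunc_dd i j k (e : j + 1 = i) (e' : k + 1 = j) :
  (trunc_pr k ∘ cx_d T e' ∘ trunc_in j) ∘ (trunc_pr j ∘ cx_d T e ∘ trunc_in i) = 0.
Proof.
have [k0|k0] := ltP k 0; first exact/to_zero/trunc_zero.
rewrite -!comp_assoc (comp_assoc (trunc_in j)) trunc_prK; last by lia.
by rewrite comp_idl (comp_assoc (cx_d T e')) cx_dd comp0m compm0.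
Qed.

(** Brutal truncation. Its inclusion into [T] is in general not compatible with the differential
    leaving degree 0, so the two complexes are isomorphic only as germs near +oo. *)
Definition truncation : complex C :=
  @Complex C trunc_obj (fun i j e => trunc_pr j ∘ cx_d T e ∘ trunc_in i) trunc_dd.

Definition to_truncation : cochain T truncation 0 := @diag C T truncation trunc_pr.
Definition from_truncation : cochain truncation T 0 := @diag C truncation T trunc_in.

Lemma to_truncation_cycle : tail_cycle at_top to_truncation.
Proof.
apply/tail_cycle0P; exists 0 => p p0 q e; rewrite /to_truncation !diag_at /=.
by rewrite -!comp_assoc trunc_prK ?comp_idr //; lia.
Qed.

Lemma from_truncation_cycle : tail_cycle at_top from_truncation.
Proof.
apply/tail_cycle0P; exists 0 => p p0 q e; rewrite /from_truncation !diag_at /=.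
by rewrite !comp_assoc trunc_prK ?comp_idl //; lia.
Qed.

Lemma to_truncationK : eventually at_top
  (comp_cochain (addr0 0) from_truncation to_truncation - id_cochain T).
Proof.
exists 0 => p p0 q e; apply: degree0_eq0; rewrite cochainBE comp0_at id_cochain_id.
by rewrite /from_truncation /to_truncation !diag_at trunc_prK ?subrr //; lia.
Qed.

Lemma from_truncationK : eventually at_top
  (comp_cochain (addr0 0) to_truncation from_truncation - id_cochain truncation).
Proof.
exists 0 => p p0 q e; apply: degree0_eq0; rewrite cochainBE comp0_at id_cochain_id.
by rewrite /from_truncation /to_truncation !diag_at trunc_inK subrr.
Qed.

Lemma truncation_augmented (Pr : C -> Prop) M (eps : hom (T 0) M) :
  augmented Pr eps -> @augmented C Pr M truncation (eps ∘ trunc_in 0).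
Proof.
case=> d0 onto ex0 ex.
have lift Q j (r : hom Q (truncation j)) i (e : j + 1 = i) (t : hom Q (T i)) : 0 <= j ->
    cx_d T e ∘ t = trunc_in j ∘ r -> exists t', cx_d truncation e ∘ t' = r.
  move=> j0 dt; exists (trunc_pr i ∘ t) => /=.
  rewrite -!comp_assoc (comp_assoc (trunc_in i)) trunc_prK ?comp_idl; last by lia.
  by rewrite dt comp_assoc trunc_inK comp_idl.
split.
- move=> i e /=; rewrite -!comp_assoc (comp_assoc (trunc_in 0)) trunc_prK // comp_idl.
  by rewrite comp_assoc d0 comp0m.
- move=> Q f PrQ; have [t <-] := onto Q f PrQ; exists (trunc_pr 0 ∘ t).
  by rewrite -comp_assoc (comp_assoc (trunc_in 0)) trunc_prK // comp_idl.
- move=> Q i e r PrQ; rewrite -comp_assoc => r0.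
  have [t dt] := ex0 Q i e _ PrQ r0; exact: lift dt.
- move=> Q j PrQ j0 i k ei ek r r0.
  have [|t dt] := ex Q j PrQ j0 i k ei ek (trunc_in j ∘ r); last by apply: lift dt; lia.
  have k0 : 0 <= k by lia.
  have r1 : trunc_in k ∘ (cx_d truncation ek ∘ r) = 0 by rewrite r0 compm0.
  move: r1; rewrite /= -!comp_assoc (comp_assoc (trunc_in k)) trunc_prK //.
  by rewrite comp_idl.
Qed.

End Truncation.

(** Extension of germs: [hom_d f] is an eventually vanishing cocycle, hence the differential of an
    eventually vanishing [h], and [f - h] is a chain map with the same germ as [f]. *)
Lemma tail_cycle_lift (C : additiveCategory) (F : tail) (X Y : complex C)
    (f : cochain X Y 0) : acyclic F X Y -> tail_cycle F f ->
  exists2 g, chain_map g & eventually F (f - g).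
Proof.
move=> ac Zf; have [|h Fh dh] := ac _ _ (int_predK 0) (hom_d (int_predK 0) f) _ (Zf _ _).
  by move=> k ek; rewrite hom_dd.
exists (f - h); last by rewrite opprB addrCA subrr addr0.
apply: (tail_cycle_ex (e := int_predK 0)).
have -> : hom_d (int_predK 0) (f - h) = hom_d (int_predK 0) f - hom_d (int_predK 0) h.
  exact: raddfB.
by rewrite dh subrr; apply: eventually0.
Qed.

Section GorensteinDimension.
Variables (C : additiveCategory) (Pr In : C -> Prop).
Hypothesis Pr_zero : forall A, is_zero_obj A -> Pr A.
Hypothesis Pr_bip : forall A B, Pr A -> Pr B -> Pr (bip A B).

Definition totally_acyclic (T : complex C) : Prop :=
  (forall p, Pr (T p)) /\ forall W j, Pr W \/ In W -> coexact_hom W T j.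

Definition gorenstein (A : C) : Prop :=
  exists (T : complex C) (eps : hom (T 0) A), totally_acyclic T /\ augmented Pr eps.

Fixpoint gorenstein_dim_le (n : nat) (A : C) : Prop :=
  if n is m.+1 then
    exists (K G : C) (x : hom K G) (y : hom G A),
      [/\ forall Q, Pr Q -> short_exact (fun u : hom Q K => x ∘ u) (fun v : hom Q G => y ∘ v),
          gorenstein G & gorenstein_dim_le m K]
  else gorenstein A.

(** Strictly inverse germs rather than homotopy inverses: this relation passes to cones by diagonal
    maps, which keeps the induction on the dimension elementary. *)
Definition isomorphic_at_top (T P : complex C) : Prop :=
  exists (u : cochain T P 0) (v : cochain P T 0),
    [/\ tail_cycle at_top u, tail_cycle at_top v,
        eventually at_top (comp_cochain (addr0 0) v u - id_cochain T)
      & eventually at_top (comp_cochain (addr0 0) u v - id_cochain P)].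

Definition has_complete_resolution (A : C) : Prop :=
  exists (P : complex C) (eps : hom (P 0) A) (T : complex C),
    [/\ resolution Pr eps, totally_acyclic T & isomorphic_at_top T P].

Lemma gorenstein_complete_resolution A : gorenstein A -> has_complete_resolution A.
Proof.
move=> [T [eps [Tac augT]]].
exists (truncation T), (eps ∘ trunc_in T 0), T; split=> //.
  split; [exact: trunc_zero| |exact: truncation_augmented].
  by move=> p /=; rewrite /trunc_obj; case: ifP => _; [apply: Tac.1|apply/Pr_zero/zobjP].
exists (to_truncation T), (from_truncation T); split.
- exact: to_truncation_cycle.
- exact: from_truncation_cycle.
- exact: to_truncationK.
- exact: from_truncationK.
Qed.

Lemma cone_resolution K G M (x : hom K G) (y : hom G M) (P P' : complex C)
    (eps : hom (P 0) K) (eps' : hom (P' 0) G) (c : cochain P P' 0) (cc : chain_map c) :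
  (forall Q, Pr Q -> short_exact (fun u : hom Q K => x ∘ u) (fun v : hom Q G => y ∘ v)) ->
  resolution Pr eps -> resolution Pr eps' -> eps' ∘ c 0 0 (addr0 0) = x ∘ eps ->
  @resolution C Pr M (cone cc) (y ∘ eps' ∘ pr1 (P' 0) (P (0 - 1))).
Proof.
move=> xy resP resP' ec; have [P0 PrP augP] := resP; have [P0' PrP' augP'] := resP'.
have P00 : is_zero_obj (P (0 - 1)) by apply: P0.
split.
- move=> p p0 /=; have p1 : p - 1 < 0 by lia.
  rewrite /is_zero_obj -bip_id (to_zero (pr1 _ _) (P0' p p0)) (to_zero (pr2 _ _) (P0 _ p1)).
  by rewrite !compm0 addr0.
- by move=> p; apply: Pr_bip.
split.
- move=> i e; case: i / e; have e1 := cone_eq1 (erefl (0 + 1 : int)).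
  have -> : y ∘ eps' ∘ pr1 (P' 0) (P (0 - 1)) ∘ cx_d (cone cc) erefl
      = y ∘ eps' ∘ (cx_d P' (erefl (0 + 1)) ∘ pr1 _ _ + c _ _ e1 ∘ pr2 _ _).
    by rewrite -[LHS]comp_assoc; congr (_ ∘ _); apply: pr1_cone_d.
  rewrite comp_addr !comp_assoc -(comp_assoc y) (aug_d augP') compm0 comp0m [LHS]add0r.
  rewrite -[X in X ∘ _]comp_assoc (_ : eps' ∘ c _ _ e1 = x ∘ eps); last first.
    by rewrite -ec; congr (_ ∘ _); exact: (congr1 (c 0 0) (eq_irrelevance _ _)).
  have [_ /(_ (x ∘ eps))[_ yx] _] := xy _ (PrP 0).
  by rewrite yx ?comp0m //; exists eps.
- move=> Q f PrQ; have [_ _ onto] := xy _ PrQ; have [g <-] := onto f.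
  have [t <-] := aug_onto augP' g PrQ; exists (in1 (P' 0) (P (0 - 1)) ∘ t).
  have tE : pr1 (P' 0) (P (0 - 1)) ∘ (in1 (P' 0) (P (0 - 1)) ∘ t) = t.
    exact: pr1_in1_comp.
  rewrite -[LHS]comp_assoc; apply: etrans (congr1 (fun g => y ∘ eps' ∘ g) tE) _.
  by rewrite comp_assoc.
- move=> Q i e r PrQ r0; case: i / e; have [_ ex _] := xy _ PrQ.
  (* Since [y] kills [eps' ∘ pr1 ∘ r], this map comes from [K]; lifting it along [eps] to [k'] and
     subtracting [c ∘ k'] leaves a map into [P' 0] killed by [eps'], hence a boundary. *)
  have [k kE] : exists k : hom Q K, x ∘ k = eps' ∘ (pr1 (P' 0) (P (0 - 1)) ∘ r).
    by apply/ex; rewrite !comp_assoc.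
  have [k' k'E] := aug_onto augP k PrQ.
  have [|a aE] := aug_exact0 augP' (erefl (0 + 1))
      (r := pr1 (P' 0) (P (0 - 1)) ∘ r - c 0 0 (addr0 0) ∘ k') PrQ.
    by rewrite comp_addr comp_oppr -kE comp_assoc ec -comp_assoc k'E subrr.
  refine (@cone_boundary _ _ _ _ cc Q (0 + 1) 0 erefl (addr0 0) (int_predK 0) r a k' _ _).
    by rewrite aE subrK.
  by rewrite (to_zero (pr2 _ _ ∘ r) P00) oppr0; apply: to_zero.
- move=> Q j PrQ j0 i k ei ek r /(cone_cycle (cone_eq1 ek) (cone_eq2 ek)).
  set a := pr1 _ _ ∘ r; set b := pr2 _ _ ∘ r => -[ab db].
  have [b' b'E] : exists b' : hom Q (P (i - 1)), cx_d P (cone_eq2 ei) ∘ b' = - b.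
    have [j1|j1] := ltP 1 j.
      have j2 : 0 < j - 1 by lia.
      have ex := aug_exact augP PrQ j2; apply: (ex _ _ (cone_eq2 ei) (cone_eq2 ek)).
      by rewrite comp_oppr db oppr0.
    (* Here [b] lands in [P 0], where the condition to check is [eps ∘ b = 0]. It follows from [x ∘
       eps ∘ b = eps' ∘ c ∘ b = - eps' ∘ d ∘ a = 0], as composition with [x] is injective. *)
    have jE : j = 1 by lia.
    move: ei ek r @a @b ab db; rewrite jE => ei ek r a b ab db.
    apply: (aug_exact0 augP (cone_eq2 ei) PrQ).
    have [inj _ _] := xy _ PrQ; apply: inj.
    have kE : k = 0 by lia.
    move: ek ab db; rewrite kE => ek ab db.
    rewrite compm0 comp_assoc -ec comp_oppr -comp_assoc (eq_irrelevance (addr0 0) (cone_eq1 ek)).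
    move: ab => /(congr1 (fun g => eps' ∘ g)).
    rewrite comp_addr compm0 comp_assoc (aug_d augP') comp0m add0r => ->.
    exact: oppr0.
  have ex := aug_exact augP' PrQ j0.
  have [|a' a'E] := ex _ _ ei ek (a - c _ _ (cone_eq1 ei) ∘ b').
    rewrite comp_addr comp_oppr comp_assoc (chain_mapE _ (cone_eq1 ek) (cone_eq2 ei)) //.
    by rewrite -comp_assoc b'E comp_oppr opprK.
  apply: (@cone_boundary _ _ _ _ cc Q _ _ ei (cone_eq1 ei) (cone_eq2 ei) r a' b') => //.
  by rewrite a'E subrK.
Qed.

Lemma complete_resolution_cone K G M (x : hom K G) (y : hom G M) :
  (forall Q, Pr Q -> short_exact (fun u : hom Q K => x ∘ u) (fun v : hom Q G => y ∘ v)) ->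
  has_complete_resolution K -> has_complete_resolution G -> has_complete_resolution M.
Proof.
move=> xy [P [eps [T [resP [PrT acT] [u [v [Zu Zv vu uv]]]]]]].
move=> [P' [eps' [T' [resP' [PrT' acT'] [u' [v' [Zu' Zv' vu' uv']]]]]]].
have [c [cc ec]] := resolution_lift resP resP' x.
(* [c] transported to the complete resolutions, where it is a chain map only near +oo. It extends to
   all degrees because C(T,-) is exact on the terms of [T'], which lie in [Pr]. *)
pose f := comp_cochain (addr0 0) v' (comp_cochain (addr0 0) c u).
have Zf : tail_cycle at_top f.
  by apply: tail_cycle_comp => //; apply: tail_cycle_comp => //; apply: tail_cycle_chain.
have [|g cg fg] := tail_cycle_lift _ Zf.
  by apply: acyclic_top => p q; apply: acT; left.
(* [g_u] and [g_v] are the strictly commuting squares that compare the cone of [g] with the cone of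
   [c], in both directions. *)
have g_u : eventually at_top (comp_cochain (addr0 0) u' g - comp_cochain (addr0 0) c u).
  have -> : comp_cochain (addr0 0) u' g - comp_cochain (addr0 0) c u
      = comp_cochain (addr0 0) (comp_cochain (addr0 0) u' v' - id_cochain P')
          (comp_cochain (addr0 0) c u) - comp_cochain (addr0 0) u' (f - g).
    rewrite comp_cochainBl comp_id_cochain comp_cochainBr /f.
    rewrite !(comp_cochainA _ (addr0 0) _ (addr0 0)).
    by rewrite opprB [RHS]addrC addrA subrK.
  by apply: eventuallyB; [exact: eventually_compl|exact: eventually_compr].
have g_v : eventually at_top (comp_cochain (addr0 0) v' c - comp_cochain (addr0 0) g v).
  have -> : comp_cochain (addr0 0) v' c - comp_cochain (addr0 0) g v
      = comp_cochain (addr0 0) (f - g) v - comp_cochain (addr0 0) (comp_cochain (addr0 0) v' c)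
          (comp_cochain (addr0 0) u v - id_cochain P).
    rewrite comp_cochainBl comp_cochainBr comp_cochain_id /f.
    rewrite !(comp_cochainA _ (addr0 0) _ (addr0 0)).
    by rewrite opprB [RHS]addrC addrA subrK.
  by apply: eventuallyB; [exact: eventually_compl|exact: eventually_compr].
exists (cone cc), (y ∘ eps' ∘ pr1 (P' 0) (P (0 - 1))), (cone cg); split.
- exact: cone_resolution ec.
- split=> [p|W j WX]; first exact: Pr_bip.
  by apply: cone_coexact; [exact: acT'|exact: acT].
- exists (cone_map cg cc u' u), (cone_map cc cg v' v); split.
  + exact: cone_map_cycle.
  + exact: cone_map_cycle.
  + exact: cone_map_inverse.
  + exact: cone_map_inverse.
Qed.

Lemma gorenstein_dim_complete_resolution n A :
  gorenstein_dim_le n A -> has_complete_resolution A.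
Proof.
elim: n A => [|n IH] A; first exact: gorenstein_complete_resolution.
move=> [K [G [x [y [xy gG]]]]] /IH cK.
exact: complete_resolution_cone xy cK (gorenstein_complete_resolution gG).
Qed.

Lemma complete_resolution_tail_homology A n (P : complex C) (eps : hom (P 0) A) :
  gorenstein_dim_le n A -> resolution Pr eps ->
  exists2 T, totally_acyclic T &
    forall Y k, ab_isomorphic (tail_homology at_top P Y k) (tail_homology at_top T Y k).
Proof.
move=> /gorenstein_dim_complete_resolution[P' [eps' [T [resP' Tac]]]].
move=> [u [v [Zu Zv vu uv]]] resP; exists T => // Y k.
apply: (ab_isomorphic_trans (tail_homology_resolution _ _ _ resP resP')).
by apply: (@tail_homology_precomp _ _ P' T Y k u v) => //; apply: tail_boundary_ev.
Qed.

End GorensteinDimension.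

(** * Comparison of the two ends *)

(** A coresolution tested by homs out of [Pr], not into the injectives: the splice has to be exact
    under these homs along its injective half too. *)
Record coaugmented (C : additiveCategory) (Pr : C -> Prop) (N : C) (I : complex C)
    (eta : hom N (I 0)) : Prop := Coaugmented {
  coaug_zero : forall p, 0 < p -> is_zero_obj (I p);
  coaug_d : forall k (e : k + 1 = 0), cx_d I e ∘ eta = 0;
  coaug_inj : forall Q (f : hom Q N), Pr Q -> eta ∘ f = 0 -> f = 0;
  coaug_exact0 : forall Q k (e : k + 1 = 0) (r : hom Q (I 0)), Pr Q ->
    cx_d I e ∘ r = 0 -> exists t, eta ∘ t = r;
  coaug_exact : forall Q j, Pr Q -> j < 0 -> exact_hom Q I j }.

Lemma coexact_hom_bip (C : additiveCategory) (A B : C) (X : complex C) j :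
  coexact_hom A X j -> coexact_hom B X j -> coexact_hom (bip A B) X j.
Proof.
move=> exA exB i k ei ek r r0.
have [|t1 ht1] := exA i k ei ek (pr1 _ _ ∘ r); first by rewrite -comp_assoc r0 compm0.
have [|t2 ht2] := exB i k ei ek (pr2 _ _ ∘ r); first by rewrite -comp_assoc r0 compm0.
exists (in1 _ _ ∘ t1 + in2 _ _ ∘ t2); apply: to_bip_eq.
  by rewrite comp_assoc comp_addr !pr_in_comp addr0.
by rewrite comp_assoc comp_addr !pr_in_comp add0r.
Qed.

Section Splice.
Variables (C : additiveCategory) (Pr : C -> Prop) (N : C) (P I : complex C).
Variables (eps : hom (P 0) N) (eta : hom N (I 0)).
Hypotheses (resP : resolution Pr eps) (coI : coaugmented Pr eta).

Definition splice_map : cochain P I 0 := patch (0 : cochain P I 0) (eta ∘ eps).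

Lemma splice_map0 (e : 0 + 0 = 0) : splice_map e = eta ∘ eps.
Proof. exact: patch_at. Qed.

Lemma splice_map_off p q (e : p + 0 = q) : p <> 0 -> splice_map e = 0.
Proof. exact: patch_off. Qed.

Lemma splice_chain_map : chain_map splice_map.
Proof.
apply/tail_cycle0P => p q e.
have [pE|p0] := eqVneq p 0.
  rewrite [splice_map (addr0 q)]splice_map_off ?comp0m; last by lia.
  move: e; rewrite pE => e.
  by rewrite splice_map0 comp_assoc (coaug_d coI) comp0m.
rewrite [splice_map (addr0 p)]splice_map_off ?compm0; last exact/eqP.
have [qE|q0] := eqVneq q 0; last by rewrite splice_map_off ?comp0m //; exact/eqP.
move: e; rewrite qE => e.
by rewrite splice_map0 -comp_assoc (aug_d (res_aug resP)) compm0.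
Qed.

(* A shift of the exact complex
   [... -> P 1 -> P 0 -> I 0 -> I (-1) -> ...] through [N]. *)
Definition splice : complex C := cone splice_chain_map.

(** In degree [j] the splice is [I j] plus [P (j - 1)], of which only the second survives for
    [j > 0] and only the first for [j <= 0]. The joints are [j = 1], where [eta] being monic on homs
    from [Q] gives a map killed by [eps], and [j = 0], where a cycle in [I 0] factors through [N]
    and is lifted along [eps]. *)
Lemma splice_exact Q j : Pr Q -> exact_hom Q splice j.
Proof.
move=> PrQ i k ei ek r /(cone_cycle (cone_eq1 ek) (cone_eq2 ek)).
set a := pr1 _ _ ∘ r; set b := pr2 _ _ ∘ r => -[ab db].
suff [t1 [t2 [h1 h2]]] : exists t1 t2, cx_d I ei ∘ t1 + splice_map (cone_eq1 ei) ∘ t2 = a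
    /\ cx_d P (cone_eq2 ei) ∘ t2 = - b.
  exact: (@cone_boundary _ _ _ _ splice_chain_map Q _ _ ei (cone_eq1 ei) (cone_eq2 ei) r t1 t2).
have augP := res_aug resP.
have [j0|j0] := ltP 0 j.
  have Ij := coaug_zero coI j0.
  suff [t2 ht2] : exists t2, cx_d P (cone_eq2 ei) ∘ t2 = - b.
    by exists 0, t2; split=> //; rewrite (to_zero a Ij); apply: to_zero.
  have [j1|j1] := ltP 1 j.
    have j2 : 0 < j - 1 by lia.
    have ex := aug_exact augP PrQ j2; apply: (ex _ _ (cone_eq2 ei) (cone_eq2 ek)).
    by rewrite comp_oppr db oppr0.
  have jE : j = 1 by lia.
  have kE : k = 0 by lia.
  move: ei ek Ij r @a @b ab db; rewrite jE kE => ei ek Ij r a b ab db.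
  apply: (aug_exact0 augP (cone_eq2 ei) PrQ); apply: (coaug_inj coI PrQ).
  rewrite comp_oppr comp_oppr comp_assoc -(splice_map0 (cone_eq1 ek)).
  by move: ab; rewrite (to_zero a Ij) compm0 add0r => ->; rewrite oppr0.
have Pj : is_zero_obj (P (j - 1)) by apply: (res_zero resP); lia.
have b0 : b = 0 by exact: to_zero.
have da : cx_d I ek ∘ a = 0 by move: ab; rewrite b0 compm0 addr0.
have [j1|j1] := ltP j 0.
  have ex := coaug_exact coI PrQ j1; have [t1 ht1] := ex _ _ ei ek a da.
  by exists t1, 0; rewrite !compm0 addr0 b0 oppr0.
have jE : j = 0 by lia.
have iE : i - 1 = 0 by lia.
move: (cone_eq1 ei) (cone_eq2 ei); rewrite iE.
move: ei ek r @a @b ab db Pj b0 da; rewrite jE => ei ek r a b ab db Pj b0 da e1 e2.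
have [t ht] := coaug_exact0 coI PrQ da.
have [t2 ht2] := aug_onto augP t PrQ.
exists 0, t2; split; last by apply: etrans (to_zero _ Pj) (esym (to_zero _ Pj)).
by rewrite compm0 add0r splice_map0 -comp_assoc ht2.
Qed.

Lemma tail_homology_splice_bottom X n :
  ab_isomorphic (tail_homology at_bottom X splice n) (tail_homology at_bottom X I n).
Proof.
apply: ab_isomorphic_sym.
pose u : cochain I splice 0 := @diag _ I splice (fun p => in1 (I p) (P (p - 1))).
pose v : cochain splice I 0 := @diag _ splice I (fun p => pr1 (I p) (P (p - 1))).
apply: (@tail_homology_postcomp _ _ X I splice n 0 n 0 (addr0 n) (addr0 n)
  (addr0 0) (addr0 0) u v).
- apply/tail_cycle0P; exists 0 => p p0 q e; rewrite /u !diag_at.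
  exact: cone_in1.
- apply/tail_cycle0P; exists 0 => p p0 q e; rewrite /v !diag_at.
  apply/esym; apply: etrans (pr1_cone_d splice_map e (cone_eq1 e)) _.
  by rewrite splice_map_off ?comp0m ?addr0 //; lia.
- apply: tail_boundary_ev; exists 0 => p p0 q e; apply: degree0_eq0.
  rewrite cochainBE comp0_at id_cochain_id /u /v !diag_at.
  by apply/eqP; rewrite subr_eq0; apply/eqP/pr1_in1.
- apply: tail_boundary_ev; exists 0 => p p0 q e; apply: degree0_eq0.
  rewrite cochainBE comp0_at id_cochain_id /u /v !diag_at.
  apply/eqP; rewrite subr_eq0; apply/eqP.
  apply: etrans _ (bip_id (I p) (P (p - 1))).
  have P0 : is_zero_obj (P (p - 1)) by apply: (res_zero resP); lia.
  by rewrite (to_zero (pr2 _ _) P0) compm0 addr0.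
Qed.

(** Near +oo the splice is [P] moved up by one degree with negated differential. That sign is the
    one [hom_d] gives to cochains of degree 1, so the plain inclusion [u] is a cycle there. *)
Lemma tail_homology_splice_top X n :
  ab_isomorphic (tail_homology at_top X P n) (tail_homology at_top X splice (n + 1)).
Proof.
have eqS (p q : int) : p + 1 = q -> p = q - 1 by lia.
have eqP' (p q : int) : p + -1 = q -> p - 1 = q by lia.
pose u : cochain P splice 1 := fun p q e => in2 (I q) (P (q - 1)) ∘ tr P (eqS p q e).
pose v : cochain splice P (-1) := fun p q e => tr P (eqP' p q e) ∘ pr2 (I p) (P (p - 1)).
apply: (@tail_homology_postcomp _ _ X P splice n 1 (n + 1) (-1) erefl (addrK 1 n)
  (subrr 1) (addNr 1) u v).
- move=> m em; exists 0 => p p0 q e.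
  have [q1 [p1 [eq ep]]] : exists q1 p1, q + 1 = q1 /\ p1 + 1 = p.
    by exists (q + 1), (p - 1); lia.
  have [h1 h2] : p + 1 = q1 /\ p1 + 1 = q by lia.
  rewrite (hom_dE _ _ _ eq h1 ep h2) expr1z mulrNz mulr1z opprK /u.
  have e1 := cone_eq1 eq; have e2 := cone_eq2 eq.
  rewrite -(comp_assoc _ _ (cx_d P ep)) (tr_d P ep e2 (eqS _ _ h1)) !comp_assoc -comp_addl.
  apply: etrans (congr1 (fun g => (g + _) ∘ _) (cone_in2 splice_chain_map eq e1 e2)) _.
  by rewrite subrK splice_map_off ?compm0 ?comp0m //; lia.
- move=> m em; exists 0 => p p0 q e.
  have [q1 [p1 [eq ep]]] : exists q1 p1, q + 1 = q1 /\ p1 + 1 = p.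
    by exists (q + 1), (p - 1); lia.
  have [h1 h2] : p + -1 = q1 /\ p1 + -1 = q by lia.
  have sgn : ((-1) ^ (-1) : int) = -1 by [].
  rewrite (hom_dE _ _ _ eq h1 ep h2) sgn mulrNz mulr1z opprK /v.
  have e2 := cone_eq2 ep; rewrite -[X in _ + X]comp_assoc.
  apply: etrans (congr1 (fun g => _ + _ ∘ g) (pr2_cone_d splice_map ep e2)) _.
  by rewrite comp_oppr !comp_assoc (tr_d P e2 eq (eqP' _ _ h1)) subrr.
- apply: tail_boundary_ev; exists 0 => p p0 q e; apply: degree0_eq0.
  rewrite cochainBE id_cochain_id (comp_cochainE _ _ _ _ erefl (addrK 1 p)) /u /v.
  apply/eqP; rewrite subr_eq0; apply/eqP.
  rewrite -comp_assoc; apply: etrans (congr1 (fun g => _ ∘ g) (pr2_in2_comp _ _)) _.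
  by rewrite tr_comp tr_id.
- apply: tail_boundary_ev; exists 0 => p p0 q e; apply: degree0_eq0.
  rewrite cochainBE id_cochain_id (comp_cochainE _ _ _ _ erefl (subrK 1 p)) /u /v.
  apply/eqP; rewrite subr_eq0; apply/eqP.
  rewrite -comp_assoc (comp_assoc (tr _ _)) tr_comp tr_id comp_idl.
  apply: etrans _ (bip_id (I p) (P (p - 1))).
  by rewrite (to_zero (pr1 _ _) (coaug_zero coI p0)) compm0 add0r.
Qed.

End Splice.

(** The comparisons with [T] and [S] enter as isomorphisms for every other argument, because [S] is
    produced in the opposite category and its comparison is only available after dualising. *)
Theorem tail_homology_complete (C : additiveCategory) (Pr In : C -> Prop)
    (N : C) (PM PN IN T S : complex C) (eps : hom (PN 0) N) (eta : hom N (IN 0)) (n : int) :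
  (forall p, In (IN p)) -> resolution Pr eps -> coaugmented Pr eta ->
  totally_acyclic Pr In T -> (forall Q j, Pr Q -> exact_hom Q S j) ->
  (forall Y k, ab_isomorphic (tail_homology at_top PM Y k) (tail_homology at_top T Y k)) ->
  (forall X k, ab_isomorphic (tail_homology at_bottom X IN k) (tail_homology at_bottom X S k)) ->
  ab_isomorphic (tail_homology at_top PM PN n) (tail_homology everywhere T S (n + 1)).
Proof.
move=> InI resP coI [PrT acT] exS toT toS.
have top : acyclic at_top T (splice resP coI).
  apply: acyclic_top => p q; apply: coexact_hom_bip; apply: acT; first by right.
  by left; apply: (res_Pr resP).
have bot : acyclic at_bottom T (splice resP coI).
  by apply: acyclic_bottom => p q; apply: splice_exact.
have botS : acyclic at_bottom T S by apply: acyclic_bottom => p q; apply: exS.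
apply: ab_isomorphic_trans (toT _ _) _.
apply: ab_isomorphic_trans (tail_homology_splice_top resP coI _ _) _.
apply: ab_isomorphic_trans (ab_isomorphic_sym (acyclic_tail_homology _ top)) _.
apply: ab_isomorphic_trans (acyclic_tail_homology _ bot) _.
apply: ab_isomorphic_trans (tail_homology_splice_bottom resP coI _ _) _.
apply: ab_isomorphic_trans (toS _ _) _.
exact: ab_isomorphic_sym (acyclic_tail_homology _ botS).
Qed.

(** * Application to proper classes *)

Lemma subcomplex_tail_homology (C : additiveCategory) (X Y : complex C)
    (S : subcomplex (hom_complex X Y)) (F : tail) n :
  (forall m (f : cochain X Y m), f \in S m <-> eventually F f) ->
  ab_isomorphic (homology (quotient_complex S) n) (tail_homology F X Y n).
Proof.
move=> SF; apply: (presents_iso (f := id) (relative_classP S n) (tail_homologyP F X Y n)).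
- by [].
- by move=> x /SF; apply: tail_cycle_ex.
- by move=> x _ [y /SF Sy]; exists (n + 1), erefl, y.
- by move=> x _ [m [e [g Fg]]]; case: m / e g Fg => g Fg; exists g; apply/SF.
- move=> w Zw; exists w; split; first exact/SF/Zw.
  by rewrite subrr; apply/tail_boundary_ev/eventually0.
Qed.

Lemma complete_ext_PE (C : additiveCategory) (X Y : complex C) i :
  ab_isomorphic (complete_ext_P X Y i) (tail_homology at_top X Y (- i)).
Proof.
apply: subcomplex_tail_homology => m f; split=> [/asboolP[b fb]|[b fb]].
  by exists b => p bp q e; apply: fb.
by apply/asboolP; exists b => p q e bp; apply: fb.
Qed.

Lemma complete_ext_IE (C : additiveCategory) (X Y : complex C) i :
  ab_isomorphic (complete_ext_I X Y i) (tail_homology at_bottom X Y (- i)).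
Proof.
apply: subcomplex_tail_homology => m f; split=> [/asboolP[b fb]|[b fb]].
  by exists b => p bp q e; apply: fb.
by apply/asboolP; exists b => p q e bp; apply: fb.
Qed.

(** * From the triangles of the class to resolutions and their duals *)

Section ExactSequences.
Variable C : additiveCategory.

Definition exact_from (Q A B D : C) (x : hom A B) (y : hom B D) : Prop :=
  short_exact (fun u : hom Q A => x ∘ u) (fun v : hom Q B => y ∘ v).

Definition exact_to (Q A B D : C) (x : hom A B) (y : hom B D) : Prop :=
  short_exact (fun u : hom D Q => u ∘ y) (fun v : hom B Q => v ∘ x).

Variables (A B D : C) (x : hom A B) (y : hom B D).

Lemma exact_from_zero Q : is_zero_obj Q -> exact_from Q x y.
Proof.
move=> Q0; split=> [u v _|v|w]; first by rewrite (from_zero u Q0) (from_zero v Q0).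
  by split=> _; [exists 0|]; apply: etrans (from_zero _ Q0) (esym (from_zero _ Q0)).
by exists 0; apply: etrans (from_zero _ Q0) (esym (from_zero _ Q0)).
Qed.

Lemma exact_from_bip Q Q' : exact_from Q x y -> exact_from Q' x y ->
  exact_from (bip Q Q') x y.
Proof.
move=> [inj ex onto] [inj' ex' onto']; split.
- move=> u v /= uv; apply: from_bip_eq; [apply: inj|apply: inj'];
  by rewrite /= !comp_assoc uv.
- move=> v; split=> [v0|[u <-]].
    have [u hu] : exists u, x ∘ u = v ∘ in1 Q Q' by apply/ex; rewrite comp_assoc v0 comp0m.
    have [u' hu'] : exists u', x ∘ u' = v ∘ in2 Q Q'.
      by apply/ex'; rewrite comp_assoc v0 comp0m.
    exists (u ∘ pr1 _ _ + u' ∘ pr2 _ _).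
    by rewrite comp_addr !comp_assoc hu hu' -!comp_assoc -comp_addr bip_id comp_idr.
  apply: from_bip_eq; rewrite comp0m -!comp_assoc.
    by apply/ex; exists (u ∘ in1 Q Q').
  by apply/ex'; exists (u ∘ in2 Q Q').
- move=> w; have [v hv] := onto (w ∘ in1 Q Q'); have [v' hv'] := onto' (w ∘ in2 Q Q').
  exists (v ∘ pr1 _ _ + v' ∘ pr2 _ _).
  by rewrite comp_addr !comp_assoc hv hv' -!comp_assoc -comp_addr bip_id comp_idr.
Qed.

End ExactSequences.

Section ResolutionOfSequences.
Variables (C : additiveCategory) (Pr In : C -> Prop) (P : complex C) (K : nat -> C).
Variables (g : forall n : nat, hom (K n.+1) (P n)) (f : forall n : nat, hom (P n) (K n)).
Hypothesis P_zero : forall n : int, n < 0 -> is_zero_obj (P n).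
Hypothesis gf_from : forall n Q, Pr Q -> exact_from Q (g n) (f n).
Hypothesis gf_to : forall n Q, In Q -> exact_to Q (g n) (f n).
Hypothesis P_d : forall (n : nat) (e : n%:Z + 1 = n.+1%:Z), cx_d P e = g n ∘ f n.+1.

Hypothesis P_Pr : forall n : int, Pr (P n).

Lemma augmentation_d (i : int) (e : 0 + 1 = i) : f 0 ∘ cx_d P e = 0.
Proof.
have iE : i = 1%N by lia.
move: e; rewrite iE => e; rewrite P_d.
have [_ /(_ (g 0 ∘ f 1))[_ ex] _] := gf_from 0 (P_Pr 1%N).
by apply: ex; exists (f 1).
Qed.

Lemma resolution_of_sequences : @resolution C Pr (K 0) P (f 0).
Proof.
split=> //; split; first exact: augmentation_d.
- by move=> Q r PrQ; have [_ _ onto] := gf_from 0 PrQ; apply: onto.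
- move=> Q i e r PrQ r0; have iE : i = 1%N by lia.
  move: e; rewrite iE => e; have [_ /(_ r)[/(_ r0)[s <-] _] _] := gf_from 0 PrQ.
  have [_ _ /(_ s)[t <-]] := gf_from 1 PrQ.
  by exists t; rewrite P_d comp_assoc.
- move=> Q [[|n]|n] PrQ // _ i k ei ek r.
  have [iE kE] : i = n.+2%:Z /\ k = n%:Z by lia.
  move: ei ek; rewrite iE kE => ei ek; rewrite P_d => r0.
  have [inj _ _] := gf_from n PrQ; have [_ /(_ r) ex _] := gf_from n.+1 PrQ.
  have fr : f n.+1 ∘ r = 0 by apply: inj; rewrite comp_assoc r0 compm0.
  have [s <-] := ex.1 fr; have [_ _ /(_ s)[t <-]] := gf_from n.+2 PrQ.
  by exists t; rewrite P_d comp_assoc.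
Qed.

(** In the dual chain of isomorphisms the projective resolution of [M] plays the part that the
    coresolution of [N] plays in the original one, with homs into [In] as test. *)
Lemma op_coaugmented_of_sequences :
  @coaugmented (opcat C) In (K 0) (op_complex P) (f 0).
Proof.
split.
- by move=> p p0; apply: P_zero; lia.
- by move=> k e; apply: (augmentation_d (opp_succ e)).
- move=> Q h InQ h0; have [inj _ _] := gf_to 0 InQ; apply: inj; apply: etrans h0 _.
  exact/esym/(comp0m (C := C)).
- move=> Q k e r InQ r0; have kE : k = -1 by lia.
  pose r' : @hom C (P 0) Q := r.
  have {r0} : r' ∘ cx_d P (opp_succ e) = 0 := r0.
  move: (opp_succ e : 0 + 1 = - k); rewrite kE => e1.
  rewrite (P_d e1) comp_assoc => r0.
  have [inj _ _] := gf_to 1 InQ; have [_ /(_ r') ex _] := gf_to 0 InQ.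
  by apply/ex/inj; apply: etrans r0 (esym (comp0m _ _)).
- move=> Q j InQ j0; apply: op_exact_hom => i k ei ek r.
  have [n jE] : exists n : nat, - j = n.+1%:Z by exists `|j|.-1; lia.
  move: ei ek r; rewrite jE => ei ek r.
  have [iE kE] : i = n.+2%:Z /\ k = n%:Z by lia.
  move: ei ek; rewrite iE kE => ei ek; rewrite P_d comp_assoc => r0.
  have [inj _ _] := gf_to n.+2 InQ; have [_ /(_ r) ex _] := gf_to n.+1 InQ.
  have rg : r ∘ g n.+1 = 0 by apply: inj; rewrite r0 comp0m.
  have [s <-] := ex.1 rg; have [_ _ /(_ s)[t <-]] := gf_to n InQ.
  by exists t; rewrite P_d comp_assoc.
Qed.

End ResolutionOfSequences.

Section CoresolutionOfSequences.
Variables (C : additiveCategory) (Pr In : C -> Prop) (I : complex C) (K : nat -> C).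
Variables (g : forall n : nat, hom (K n) (I (- n%:Z)))
  (f : forall n : nat, hom (I (- n%:Z)) (K n.+1)).
Hypothesis I_zero : forall n : int, 0 < n -> is_zero_obj (I n).
Hypothesis gf_from : forall n Q, Pr Q -> exact_from Q (g n) (f n).
Hypothesis gf_to : forall n Q, In Q -> exact_to Q (g n) (f n).
Hypothesis I_d : forall (n : nat) (e : - n.+1%:Z + 1 = - n%:Z), cx_d I e = g n.+1 ∘ f n.
Hypothesis I_In : forall n : int, In (I n).

Lemma op_resolution_of_sequences :
  @resolution (opcat C) In (K 0) (op_complex I) (g 0).
Proof.
apply: (@resolution_of_sequences (opcat C) In (op_complex I) K f g).
- by move=> n n0; apply: I_zero; lia.
- by move=> n Q InQ; have [inj ex onto] := gf_to n InQ; split.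
- by move=> n e; apply: I_d.
- by move=> n; apply: I_In.
Qed.

Lemma coaugmented_of_sequences : @coaugmented C Pr (K 0) I (g 0).
Proof.
split=> //.
- move=> k e; have kE : k = - 1%:Z by lia.
  move: e; rewrite kE => e; rewrite (I_d (n := 0) e).
  have [_ /(_ (g 1 ∘ f 0))[_ ex] _] := gf_to 0 (I_In (- 1%:Z)).
  by apply: ex; exists (g 1).
- move=> Q h PrQ h0; have [inj _ _] := gf_from 0 PrQ.
  by apply: inj; rewrite h0 compm0.
- move=> Q k e r PrQ; have kE : k = - 1%:Z by lia.
  move: e; rewrite kE => e; rewrite (I_d (n := 0) e) -comp_assoc => r0.
  have [inj _ _] := gf_from 1 PrQ; have [_ /(_ r) ex _] := gf_from 0 PrQ.
  by apply/ex/inj; rewrite r0 compm0.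
- move=> Q j PrQ j0 i k ei ek r.
  have [n jE] : exists n : nat, j = - n.+1%:Z by exists `|j|.-1; lia.
  move: ei ek r; rewrite jE => ei ek r.
  have [iE kE] : i = - n%:Z /\ k = - n.+2%:Z by lia.
  move: ei ek; rewrite iE kE => ei ek; rewrite I_d -comp_assoc => r0.
  have [inj _ _] := gf_from n.+2 PrQ; have [_ /(_ r) ex _] := gf_from n.+1 PrQ.
  have fr : f n.+1 ∘ r = 0 by apply: inj; rewrite r0 compm0.
  have [s <-] := ex.1 fr; have [_ _ /(_ s)[t <-]] := gf_from n PrQ.
  by exists t; rewrite I_d comp_assoc.
Qed.

End CoresolutionOfSequences.

Section GorensteinOfSequences.
Variables (C : additiveCategory) (Pr In : C -> Prop) (X : complex C) (K : int -> C).
Variables (g : forall m n : int, n + 1 = m -> hom (K m) (X n))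
  (f : forall p q : int, p = q -> hom (X p) (K q)).
Hypothesis X_Pr : forall n, Pr (X n).
Hypothesis gf_from : forall m n q (e : n + 1 = m) (e' : n = q) Q, Pr Q ->
  exact_from Q (g e) (f e').
Hypothesis gf_to : forall m n q (e : n + 1 = m) (e' : n = q) Q, Pr Q \/ In Q ->
  exact_to Q (g e) (f e').
Hypothesis X_d : forall m n (e : n + 1 = m), cx_d X e = g e ∘ f (erefl m).

Fact shift_eq (k i j : int) : j + 1 = i -> j + k + 1 = i + k.
Proof. lia. Qed.

Definition shift_complex (k : int) : complex C :=
  @Complex C (fun p => X (p + k)) (fun i j e => cx_d X (shift_eq k e))
    (fun i j l e e' => cx_dd X (shift_eq k e) (shift_eq k e')).

(** [gorenstein] wants the object augmented in degree 0, hence the shift by [k]. The shifted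
    differential carries no sign, which is harmless since only exactness matters. *)
Lemma gorenstein_of_sequences k : gorenstein Pr In (K k).
Proof.
exists (shift_complex k), (f (add0r k)); split.
  split=> [p|W j WX i l ei el r]; first exact: X_Pr.
  rewrite /= !X_d comp_assoc => r0.
  have [inj _ _] := gf_to (erefl _) (erefl (i + k)) WX.
  have rg : r ∘ g (shift_eq k ei) = 0 by apply: inj; rewrite r0 comp0m.
  have [_ ex _] := gf_to (shift_eq k ei) (erefl (j + k)) WX.
  have [s <-] := (ex r).1 rg.
  have [_ _ /(_ s)[t <-]] := gf_to (shift_eq k el) (erefl (l + k)) WX.
  by exists t; rewrite comp_assoc.
split.
- move=> i e /=; rewrite X_d comp_assoc.
  have [_ /(_ (g (shift_eq k e) ∘ f erefl))[_ ex] _] :=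
    gf_from (shift_eq k e) (add0r k) (X_Pr (i + k)).
  by rewrite -comp_assoc ex //; exists (f erefl).
- move=> Q h PrQ; have [_ _ onto] := gf_from (erefl (0 + k + 1)) (add0r k) PrQ.
  exact: onto.
- move=> Q i e r PrQ r0.
  have [_ /(_ r)[/(_ r0)[s <-] _] _] := gf_from (shift_eq k e) (add0r k) PrQ.
  have [_ _ /(_ s)[t <-]] := gf_from (erefl _) (erefl (i + k)) PrQ.
  by exists t; rewrite /= X_d comp_assoc.
- move=> Q j PrQ _ i l ei el r; rewrite /= !X_d -comp_assoc => r0.
  have [inj _ _] := gf_from (shift_eq k el) (erefl (l + k)) PrQ.
  have fr : f erefl ∘ r = 0 by apply: inj; rewrite r0 compm0.
  have [_ /(_ r)[/(_ fr)[s <-] _] _] := gf_from (shift_eq k ei) (erefl (j + k)) PrQ.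
  have [_ _ /(_ s)[t <-]] := gf_from (erefl _) (erefl (i + k)) PrQ.
  by exists t; rewrite comp_assoc.
Qed.

End GorensteinOfSequences.

Section Relative.
Variables (C : extriangulatedCategory) (xi : triangle_class C).

Notation Pr := (xi_projective xi).
Notation In := (xi_injective xi).

Lemma xi_projective_zero A : is_zero_obj A -> Pr A.
Proof. by move=> A0 U V W x y d _; apply: exact_from_zero. Qed.

Lemma xi_projective_bip A B : Pr A -> Pr B -> Pr (bip A B).
Proof.
by move=> PA PB U V W x y d xyd; apply: exact_from_bip; [apply: PA xyd|apply: PB xyd].
Qed.

Lemma xi_injective_zero A : is_zero_obj A -> In A.
Proof.
by move=> A0 U V W x y d _; apply: (@exact_from_zero (opcat C) W V U y x).
Qed.

Lemma xi_injective_bip A B : In A -> In B -> In (bip A B).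
Proof.
move=> PA PB U V W x y d xyd.
by apply: (@exact_from_bip (opcat C) W V U y x A B); [apply: PA xyd|apply: PB xyd].
Qed.

(** Loosens the literal index [n + 1] to any equal degree. [R] ranges over all properties of
    composable pairs, so both kinds of exactness are carried along. *)
Lemma exact_with_sequences (X : complex C) (K : int -> C)
    (g : forall n, hom (K (n + 1)) (X n)) (f : forall n, hom (X n) (K n)) :
  xi_exact_with xi g f ->
  exists (g' : forall m n : int, n + 1 = m -> hom (K m) (X n))
    (f' : forall p q : int, p = q -> hom (X p) (K q)),
  [/\ forall m n (e : n + 1 = m), cx_d X e = g' _ _ e ∘ f' _ _ (erefl m)
    & forall m n q (e : n + 1 = m) (e' : n = q)
        (R : forall A B D : C, hom A B -> hom B D -> Prop),
        R _ _ _ (g n) (f n) -> R _ _ _ (g' m n e) (f' n q e')].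
Proof.
move=> [_ dE].
exists (fun m n e => match e in _ = r return hom (K r) (X n) with erefl => g n end).
exists (fun p q e => match e in _ = r return hom (X p) (K r) with erefl => f p end).
by split=> [m n e|m n q e e' R]; [case: m / e|case: m / e; case: q / e'].
Qed.

Lemma xiG_projective_gorenstein A : xiG_projective xi A -> gorenstein Pr In A.
Proof.
move=> [X [K [g [f [ex XP to [n <-]]]]]].
have [tri _] := ex; have [g' [f' [dE gf]]] := exact_with_sequences ex.
apply: (@gorenstein_of_sequences C Pr In X K g' f') => //.
- move=> m k q e e' Q PrQ; apply: (gf m k q e e' (fun _ _ _ x y => exact_from Q x y)).
  by have [d xid] := tri k; apply: PrQ xid.
- move=> m k q e e' Q QX; apply: (gf m k q e e' (fun _ _ _ x y => exact_to Q x y)).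
  case: QX => [PrQ|InQ]; first exact: to.
  by have [d xid] := tri k; apply: InQ xid.
Qed.

Lemma xiG_injective_gorenstein A :
  xiG_injective xi A -> @gorenstein (opcat C) In Pr A.
Proof.
move=> [X [K [g [f [ex XI from [n <-]]]]]].
have [tri _] := ex; have [g' [f' [dE gf]]] := exact_with_sequences ex.
have gE (m k : int) : k + 1 = m -> - k = 1 - m by lia.
have fE (p q : int) : p = q -> - p + 1 = 1 - q by lia.
(* In the opposite complex the term of degree [p] is [X (- p)], and the object it maps onto is the
   one that embeds into [X (- p)] in [C], namely [K (1 - p)]. *)
have -> : K n = K (1 - (1 - n)) by congr K; lia.
apply: (@gorenstein_of_sequences (opcat C) In Pr (op_complex X) (fun p => K (1 - p))
  (fun m k e => f' (- k) (1 - m) (gE m k e))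
  (fun p q e => g' (1 - q) (- p) (fE p q e))).
- by move=> p; apply: XI.
- move=> m k q e e' Q InQ.
  have := gf (1 - q) (- k) (1 - m) (fE k q e') (gE m k e)
    (fun _ _ _ x y => @exact_to C Q _ _ _ x y).
  by apply; have [d xid] := tri (- k); apply: InQ xid.
- move=> m k q e e' Q QX.
  have := gf (1 - q) (- k) (1 - m) (fE k q e') (gE m k e)
    (fun _ _ _ x y => @exact_from C Q _ _ _ x y).
  apply; case: QX => [InQ|PrQ]; first exact: from.
  by have [d xid] := tri (- k); apply: PrQ xid.
- move=> m k e; apply: etrans (dE _ _ (opp_succ e)) _.
  have gen r (e1 : - k = r) (e2 : - m + 1 = r) (e3 : - m + 1 = - k) :
      g' _ _ e3 ∘ f' _ _ erefl = g' r _ e2 ∘ f' _ _ e1.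
    by case: r / e1 e2 => e2; rewrite (eq_irrelevance e2 e3).
  exact: gen.
Qed.

Lemma xiG_projdim_gorenstein n A : xiG_projdim_le xi n A -> gorenstein_dim_le Pr In n A.
Proof.
elim: n A => [|n IH] A; first exact: xiG_projective_gorenstein.
move=> [K [G [x [y [d [xid /xiG_projective_gorenstein gG /IH gK]]]]]].
by exists K, G, x, y; split=> // Q PrQ; apply: PrQ xid.
Qed.

Lemma xiG_injdim_gorenstein n A :
  xiG_injdim_le xi n A -> @gorenstein_dim_le (opcat C) In Pr n A.
Proof.
elim: n A => [|n IH] A; first exact: xiG_injective_gorenstein.
move=> [G [K [x [y [d [xid /xiG_injective_gorenstein gG /IH gK]]]]]].
by exists K, G, y, x; split=> // Q InQ; apply: InQ xid.
Qed.

Lemma projective_resolutionP M P : xi_projective_resolution xi M P ->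
  [/\ forall p, Pr (P p), exists eps : hom (P 0) M, resolution Pr eps
    & exists eps : hom (P 0) M, @coaugmented (opcat C) In M (op_complex P) eps].
Proof.
move=> [P0 PrP [L [g [f [tri dE]]]]].
have PrP' p : Pr (P p).
  by case: (ltP p 0) => [/P0/xi_projective_zero//|]; case: p => // n _.
have from n Q : Pr Q -> exact_from Q (g n) (f n).
  by move=> PrQ; have [d xid] := tri n; apply: PrQ xid.
have to n Q : In Q -> exact_to Q (g n) (f n).
  by move=> InQ; have [d xid] := tri n; apply: InQ xid.
split=> //; exists (f 0); first exact: (@resolution_of_sequences C Pr P (syzygy M L) g f).
exact: (@op_coaugmented_of_sequences C Pr In P (syzygy M L) g f).
Qed.

Lemma injective_coresolutionP N I : xi_injective_coresolution xi N I ->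
  [/\ forall p, In (I p), exists eta : hom N (I 0), coaugmented Pr eta
    & exists eta : hom N (I 0), @resolution (opcat C) In N (op_complex I) eta].
Proof.
move=> [I0 InI [L [g [f [tri dE]]]]].
have InI' p : In (I p).
  case: (ltP 0 p) => [/I0/xi_injective_zero//|p0].
  by have -> : p = - `|p|%N%:Z by lia.
have from n Q : Pr Q -> exact_from Q (g n) (f n).
  by move=> PrQ; have [d xid] := tri n; apply: PrQ xid.
have to n Q : In Q -> exact_to Q (g n) (f n).
  by move=> InQ; have [d xid] := tri n; apply: InQ xid.
split=> //; exists (g 0).
  exact: (@coaugmented_of_sequences C Pr In I (syzygy N L) g f).
exact: (@op_resolution_of_sequences C In I (syzygy N L) g f).
Qed.

End Relative.

Lemma unop_exact_hom (C : additiveCategory) (Q : C) (X : complex (opcat C)) j :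
  coexact_hom (C := opcat C) Q X (- j) -> exact_hom Q (unop_complex X) j.
Proof.
move=> ex i k ei ek r r0.
have [t ht] := ex _ _ (opp_succ ek) (opp_succ ei) r r0.
by exists t.
Qed.

Theorem proposition4p3 (C : extriangulatedCategory) (hWIC : WIC C)
  (xi : triangle_class C) (hxi : proper_class xi)
  (hproj : enough_xi_projectives xi) (hinj : enough_xi_injectives xi)
  (M N : C)
  (hM : finite_xiG_projdim xi M) (hN : finite_xiG_injdim xi N)
  (PM PN IM IN : complex C)
  (hPM : xi_projective_resolution xi M PM)
  (hPN : xi_projective_resolution xi N PN)
  (hIM : xi_injective_coresolution xi M IM)
  (hIN : xi_injective_coresolution xi N IN)
  (i : int) :
  ab_isomorphic (complete_ext_P PM PN i) (complete_ext_I IM IN i).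
Proof.
have [PrPM [epsM resPM] [epsM' coPM]] := projective_resolutionP hPM.
have [_ [epsN resPN] _] := projective_resolutionP hPN.
have [_ _ [etaM resIM]] := injective_coresolutionP hIM.
have [InIN [etaN coIN] [etaN' resIN]] := injective_coresolutionP hIN.
have [m /xiG_projdim_gorenstein gM] := hM.
have [n /xiG_injdim_gorenstein gN] := hN.
have [T acT toT] := complete_resolution_tail_homology (@xi_projective_zero C xi)
  (@xi_projective_bip C xi) gM resPM.
(* The same construction in the opposite category, so [S] is a complex over [opcat C];
   [unop_complex S] is the complex of injectives that targets the first chain. *)
have [S acS toS] := @complete_resolution_tail_homology (opcat C) _ _
  (@xi_injective_zero C xi) (@xi_injective_bip C xi) _ _ _ _ gN resIN.
have sideP : ab_isomorphic (tail_homology at_top PM PN (- i))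
    (tail_homology everywhere T (unop_complex S) (- i + 1)).
  apply: (@tail_homology_complete C (xi_projective xi) (xi_injective xi) N PM PN IN
    T (unop_complex S) epsN etaN) => //.
    by move=> Q j PrQ; apply/unop_exact_hom/(acS.2); right.
  move=> X k.
  apply: ab_isomorphic_trans
    (tail_homology_op (op_complexP X) (op_complexP IN) at_top_opp k) _.
  apply: ab_isomorphic_trans (toS _ _) _; apply: ab_isomorphic_sym.
  exact: (tail_homology_op (op_complexP X) (unop_complexP S) at_top_opp k).
(* The injective side, read in the opposite category: [S] replaces [T], the dual coresolutions of
   [N] and [M] replace [PM] and [PN], and the dual of [PM] serves as coresolution of [M]. *)
have sideI : ab_isomorphic
    (tail_homology (C := opcat C) at_top (op_complex IN) (op_complex IM) (- i))
    (tail_homology (C := opcat C) everywhere S (op_complex T) (- i + 1)).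
  apply: (@tail_homology_complete (opcat C) (xi_injective xi) (xi_projective xi)
    M (op_complex IN) (op_complex IM) (op_complex PM) S (op_complex T) etaM epsM') => //.
  - by move=> p; apply: PrPM.
  - by move=> Q j InQ; apply/op_exact_hom/(acT.2); right.
  - move=> X k; apply: ab_isomorphic_trans (ab_isomorphic_sym
      (tail_homology_op (op_complexP PM) (unop_complexP X) at_bottom_opp k)) _.
    apply: ab_isomorphic_trans (toT _ _) _.
    exact: (tail_homology_op (op_complexP T) (unop_complexP X) at_bottom_opp k).
apply: ab_isomorphic_trans (complete_ext_PE _ _ _) _.
apply: ab_isomorphic_trans sideP _; apply: ab_isomorphic_sym.
apply: ab_isomorphic_trans (complete_ext_IE _ _ _) _.
apply: ab_isomorphic_trans
  (tail_homology_op (op_complexP IM) (op_complexP IN) at_top_opp _) _.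
apply: ab_isomorphic_trans sideI _; apply: ab_isomorphic_sym.
(* Both sides have become the full Hom complex between the same two complexes, in the same degree
   [- i + 1], once in [C] and once in its opposite. *)
exact: (tail_homology_op (op_complexP T) (unop_complexP S) everywhere_opp _).
Qed.
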